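(* Let $|\Psi\rangle\in\mathcal{B}^n$ be a stabilizer state with full local ranks shared by three parties $M=\{A,B,C\}$, with stabilizer group $S$. Let $S_{loc}=S_{\hat A}+S_{\hat B}+S_{\hat C}$, $p=\dim(S)-\dim(S_{loc})$, and $d(\alpha)=\dim(S_{\hat\alpha})$ for $\alpha\in M$. Then $d(\alpha)-p$ is a non-negative even integer for each $\alpha$, and $|\Psi\rangle$ is LCU-equivalent to the tensor product of: $(d(A)-p)/2$ copies of $|\Psi^+\rangle$ shared by $B$ and $C$; $(d(B)-p)/2$ copies of $|\Psi^+\rangle$ shared by $C$ and $A$; $(d(C)-p)/2$ copies of $|\Psi^+\rangle$ shared by $A$ and $B$; and $p$ copies of $|\Psi_3^+\rangle$ shared by $A$, $B$, $C$ (one qubit each).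
   Context: Let $G^n\cong\mathbb{F}_2^{2n}$, with elements $f=(a_1,b_1,\dots,a_n,b_n)$; $\sigma_{00}=I,\sigma_{10}=\sigma^x,\sigma_{01}=\sigma^z,\sigma_{11}=\sigma^y$, $\sigma(f)=\sigma_{a_1b_1}\otimes\cdots\otimes\sigma_{a_nb_n}$ on $\mathcal{B}^n=(\mathbb{C}^2)^{\otimes n}$; symplectic form $\omega(f,f')=\sum_j(a_jb_j'+b_ja_j')\bmod 2$. A stabilizer state with stabilizer group $S$ ($S$ self-dual, i.e. $S=\{f:\omega(f,g)=0\ \forall g\in S\}$) is the unique up-to-phase unit vector with $\sigma(f)|\Psi\rangle=\epsilon(f)|\Psi\rangle$ for all $f\in S$ for fixed consistent signs. The Clifford group $\mathcal{C}(k)$ is the set of unitaries $U$ on $k$ qubits with $U\sigma(f)U^\dagger=\pm\sigma(u(f))$ for all $f$ for some map $u$. Party $\alpha$ holds $n_\alpha$ qubits, $n=\sum_\alpha n_\alpha$; $f_\alpha$ is the restriction of $f$ to party $\alpha$'s qubits; local subgroup $S_\alpha=\{g\in S:g_\beta=0\ \forall\beta\ne\alpha\}$, co-local subgroup $S_{\hat\alpha}=\{g\in S:g_\alpha=0\}$. Full local ranks: $S_\alpha=0$ for all $\alpha$. Two $M$-party states are LCU-equivalent if one equals $\bigotimes_\alpha U_\alpha$ applied to the other (up to global phase), $U_\alpha\in\mathcal{C}(n_\alpha)$ acting on party $\alpha$'s qubits. $|\Psi^+\rangle=\frac1{\sqrt2}(|00\rangle+|11\rangle)$ and $|\Psi_3^+\rangle=\frac1{\sqrt2}(|000\rangle+|111\rangle)$.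 *)

(* Defs.v *)
From HB Require Import structures.
From mathcomp Require Import all_boot all_order all_algebra all_field.
Set Implicit Arguments. Unset Strict Implicit. Unset Printing Implicit Defensive.
Import Order.TTheory GRing.Theory Num.Theory.
Local Open Scope ring_scope.

(* An element f = (a_1,b_1,...,a_k,b_k) of G^k is stored as the pair (a, b)
   of row vectors a = (a_j)_j, b = (b_j)_j over F_2. *)
Definition G (k : nat) := ('rV['F_2]_k * 'rV['F_2]_k)%type.

Definition sympl k (f g : G k) : 'F_2 :=
  \sum_(j < k) (f.1 0 j * g.2 0 j + f.2 0 j * g.1 0 j).

Definition G3 (nA nB nC : nat) := (G nA * G nB * G nC)%type.

Definition sympl3 nA nB nC (f g : G3 nA nB nC) : 'F_2 :=
  sympl f.1.1 g.1.1 + sympl f.1.2 g.1.2 + sympl f.2 g.2.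

Section Restrictions.
Variables nA nB nC : nat.
Definition restrA (f : G3 nA nB nC) : G nA := f.1.1.
Definition restrB (f : G3 nA nB nC) : G nB := f.1.2.
Definition restrC (f : G3 nA nB nC) : G nC := f.2.
Fact restrA_linear : linear restrA. Proof. by []. Qed.
Fact restrB_linear : linear restrB. Proof. by []. Qed.
Fact restrC_linear : linear restrC. Proof. by []. Qed.
HB.instance Definition _ := GRing.isLinear.Build 'F_2 (G3 nA nB nC) (G nA) _ restrA restrA_linear.
HB.instance Definition _ := GRing.isLinear.Build 'F_2 (G3 nA nB nC) (G nB) _ restrB restrB_linear.
HB.instance Definition _ := GRing.isLinear.Build 'F_2 (G3 nA nB nC) (G nC) _ restrC restrC_linear.

Definition zeroA : {vspace G3 nA nB nC} := lker (linfun restrA).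
Definition zeroB : {vspace G3 nA nB nC} := lker (linfun restrB).
Definition zeroC : {vspace G3 nA nB nC} := lker (linfun restrC).

Lemma mem_zeroA f : (f \in zeroA) = (restrA f == 0).
Proof. by rewrite memv_ker lfunE. Qed.

Definition colocA (S : {vspace G3 nA nB nC}) := (S :&: zeroA)%VS.
Definition colocB (S : {vspace G3 nA nB nC}) := (S :&: zeroB)%VS.
Definition colocC (S : {vspace G3 nA nB nC}) := (S :&: zeroC)%VS.

Definition locA (S : {vspace G3 nA nB nC}) := (S :&: zeroB :&: zeroC)%VS.
Definition locB (S : {vspace G3 nA nB nC}) := (S :&: zeroC :&: zeroA)%VS.
Definition locC (S : {vspace G3 nA nB nC}) := (S :&: zeroA :&: zeroB)%VS.

Definition Sloc (S : {vspace G3 nA nB nC}) := (colocA S + colocB S + colocC S)%VS.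

Definition self_dual (S : {vspace G3 nA nB nC}) : Prop :=
  forall f, f \in S <-> (forall g, g \in S -> sympl3 f g = 0).
End Restrictions.

Section Quantum.
Variable C : numClosedFieldType.   (* complex numbers (any numeric closed field, e.g. C or algC) *)

(* computational basis of B^k = (C^2)^{(x)k}: bit strings; false = |0>, true = |1> *)
Definition bits (k : nat) := {ffun 'I_k -> bool}.

(* operators on B^k as matrices indexed by basis states (row, column) *)
Definition op (k : nat) := bits k -> bits k -> C.

Definition opmul k (U V : op k) : op k := fun x z => \sum_(y : bits k) U x y * V y z.
Definition adj k (U : op k) : op k := fun x y => (U y x)^*.
Definition opscale k (s : C) (U : op k) : op k := fun x y => s * U x y.
Definition opid k : op k := fun x y => (x == y)%:R.

(* one-qubit Paulis sigma_{ab}: 00 = I, 10 = X, 01 = Z, 11 = Y; entry (r, s) *)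
Definition sigma1 (a b : bool) (r s : bool) : C :=
  match a, b with
  | false, false => (r == s)%:R
  | true, false => (r != s)%:R
  | false, true => if r == s then (if r then -1 else 1) else 0
  | true, true => if r == s then 0 else (if r then 'i else - 'i)
  end.

Definition sigma k (f : G k) : op k := fun x y =>
  \prod_(j < k) sigma1 (f.1 0 j != 0) (f.2 0 j != 0) (x j) (y j).

Definition unitary k (U : op k) : Prop := opmul U (adj U) = @opid k.

Definition clifford k (U : op k) : Prop :=
  unitary U /\
  forall f : G k, exists (g : G k) (s : C), (s = 1 \/ s = -1) /\
    opmul (opmul U (sigma f)) (adj U) = opscale s (sigma g).

Definition state3 (nA nB nC : nat) := bits nA -> bits nB -> bits nC -> C.

Definition apply3 nA nB nC (UA : op nA) (UB : op nB) (UC : op nC)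
  (psi : state3 nA nB nC) : state3 nA nB nC := fun x y z =>
  \sum_(x' : bits nA) \sum_(y' : bits nB) \sum_(z' : bits nC)
    UA x x' * UB y y' * UC z z' * psi x' y' z'.

Definition sigma3 nA nB nC (f : G3 nA nB nC) (psi : state3 nA nB nC) :=
  apply3 (sigma f.1.1) (sigma f.1.2) (sigma f.2) psi.

Definition unit_vector nA nB nC (psi : state3 nA nB nC) : Prop :=
  \sum_(x : bits nA) \sum_(y : bits nB) \sum_(z : bits nC) `|psi x y z| ^+ 2 = 1.

Definition stabilizer_state nA nB nC (S : {vspace G3 nA nB nC})
  (psi : state3 nA nB nC) : Prop :=
  self_dual S /\ unit_vector psi /\
  forall f, f \in S -> exists e : C, (e = 1 \/ e = -1) /\
    sigma3 f psi = (fun x y z => e * psi x y z).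

Definition LCU_equiv nA nB nC (psi phi : state3 nA nB nC) : Prop :=
  exists (UA : op nA) (UB : op nB) (UC : op nC) (c : C),
    [/\ clifford UA, clifford UB, clifford UC, `|c| = 1 &
        forall x y z, psi x y z = c * apply3 UA UB UC phi x y z].

Definition getb k (x : bits k) (i : nat) : bool :=
  match @insub nat (fun i => i < k)%N _ i with Some j => x j | None => false end.

Definition bell (a b : bool) : C := if a == b then (sqrtC 2)^-1 else 0.
Definition ghz (a b c : bool) : C := if (a == b) && (b == c) then (sqrtC 2)^-1 else 0.

(* Tensor product of kA Bell pairs shared by B and C, kB Bell pairs shared by
   C and A, kC Bell pairs shared by A and B, and p GHZ states (one qubit at
   each party).  Qubit layout (the order inside each party is irrelevant up
   to local SWAPs, which are Clifford):
     A : [AB pairs (kC)] [CA pairs (kB)] [GHZ (p)]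
     B : [AB pairs (kC)] [BC pairs (kA)] [GHZ (p)]
     C : [CA pairs (kB)] [BC pairs (kA)] [GHZ (p)]
   This is a state of B^nA (x) B^nB (x) B^nC when nA = kC + kB + p,
   nB = kC + kA + p and nC = kB + kA + p. *)
Definition target nA nB nC (kA kB kC p : nat) : state3 nA nB nC := fun x y z =>
  (\prod_(i < kC) bell (getb x i) (getb y i)) *
  (\prod_(i < kB) bell (getb x (kC + i)) (getb z i)) *
  (\prod_(i < kA) bell (getb y (kC + i)) (getb z (kB + i))) *
  (\prod_(i < p) ghz (getb x (kC + kB + i)) (getb y (kC + kA + i)) (getb z (kB + kA + i))).
End Quantum.

(* Main.v *)
Require Import Defs.
From HB Require Import structures.
From mathcomp Require Import all_boot all_order all_algebra all_field.
From mathcomp Require Import zify ring.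
From Stdlib Require Import FunctionalExtensionality.
Set Implicit Arguments. Unset Strict Implicit. Unset Printing Implicit Defensive.
Import Order.TTheory GRing.Theory Num.Theory.
Local Open Scope ring_scope.

(** The forms [omega_A], [omega_B], [omega_C] (symplectic form of each party's
    restrictions) are alternating on [S], sum to zero there, and by full local
    ranks have the co-local subgroups as radicals.  Counting dimensions, the
    [omega_A]-orthogonal of [S_C^] in [S] is [S_A^ + S_B^]; hence the radical of
    [omega_A] on [S_C^] is [S_C^ :&: (S_A^ + S_B^)], of dimension [p], and
    [S_C^] is that radical plus hyperbolic planes, one for each Bell pair of A
    and B.  A basis [t] of the radical splits as [tC = tA + tB] and gives the
    [ZZ] stabilizers of the GHZ states; dual elements [x] of [S], made orthogonal
    to all the hyperbolic planes and then isotropic for the three forms by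
    adding combinations of [tC] and [tB], give their [XXX] stabilizers.

    Restricting to one party yields a symplectic basis of its Pauli group, and
    the Clifford unitary carrying the standard generators to it is an operator
    [M] with [P(a_i) M = +- M P(b_i)]: a joint fixed vector of commuting
    involutions.  Signs are chosen so that the pulled-back state is fixed by the
    stabilizers of the target without signs, and these equations determine it
    up to a scalar. *)

(** * Alternating forms over the two-element field *)

(* The field is kept abstract because conversion unfolds the construction of
   ['F_2]. *)
Section TwoElementField.
Variable F : fieldType.
Hypothesis F2P : forall a : F, a = 0 \/ a = 1.

Lemma F2_addxx (a : F) : a + a = 0.
Proof.
have [h|h] := F2P (1 + 1); first by rewrite -[a]mulr1 -mulrDr h mulr0.
by move: h => /(canRL (addrK _)); rewrite subrr => /eqP; rewrite oner_eq0.
Qed.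

Lemma F2_opp (a : F) : - a = a.
Proof. by apply/eqP; rewrite eq_sym -addr_eq0 F2_addxx. Qed.

Lemma F2_addv (V : lmodType F) (v : V) : v + v = 0.
Proof. by rewrite -[v]scale1r -scalerDl F2_addxx scale0r. Qed.

Lemma F2_oppv (V : lmodType F) (v : V) : - v = v.
Proof. by apply/eqP; rewrite eq_sym -addr_eq0 F2_addv. Qed.

Definition altform (V : vectType F) (w : V -> V -> F) : Prop :=
  [/\ forall a u v x, w (a *: u + v) x = a * w u x + w v x,
      forall u v, w u v = w v u & forall u, w u u = 0].

Section AltForm.
Variables (V : vectType F) (w : V -> V -> F).
Hypothesis hw : altform w.

Lemma altC u v : w u v = w v u. Proof. by case: hw. Qed.
Lemma alt_xx u : w u u = 0. Proof. by case: hw. Qed.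
Lemma altDl u v x : w (u + v) x = w u x + w v x.
Proof. by case: hw => h _ _; have := h 1 u v x; rewrite scale1r mul1r. Qed.
Lemma alt0l x : w 0 x = 0.
Proof. by apply: (@addrI _ (w 0 x)); rewrite -altDl !addr0. Qed.
Lemma altZl a u x : w (a *: u) x = a * w u x.
Proof. by case: hw => h _ _; have := h a u 0 x; rewrite !addr0 alt0l addr0. Qed.
Lemma altDr u v x : w x (u + v) = w x u + w x v.
Proof. by rewrite altC altDl !(altC _ x). Qed.
Lemma alt0r x : w x 0 = 0. Proof. by rewrite altC alt0l. Qed.
Lemma altZr a u x : w x (a *: u) = a * w x u.
Proof. by rewrite altC altZl altC. Qed.
Lemma alt_sumr I (r : seq I) P (E : I -> V) x :
  w x (\sum_(i <- r | P i) E i) = \sum_(i <- r | P i) w x (E i).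
Proof. by elim/big_rec2: _ => [|i y z _ <-]; rewrite ?alt0r ?altDr. Qed.
Lemma alt_suml I (r : seq I) P (E : I -> V) x :
  w (\sum_(i <- r | P i) E i) x = \sum_(i <- r | P i) w (E i) x.
Proof. by rewrite altC alt_sumr; apply: eq_bigr => i _; rewrite altC. Qed.

(** By hypothesis the columns of the matrix of pairings of a basis of [S] with the [b i] are
    independent, so its rows span all vectors of values. *)
Lemma pairing_onto (S : {vspace V}) m (b : 'I_m -> V) :
  (forall c : 'I_m -> F,
     (forall s, s \in S -> w s (\sum_i c i *: b i) = 0) -> forall i, c i = 0) ->
  forall c : 'I_m -> F, exists2 s, s \in S & forall i, w s (b i) = c i.
Proof.
move=> hb c.
pose A := \matrix_(j < \dim S, i < m) w (vbasis S)`_j (b i).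
have hA : row_full A.
  rewrite /row_full -mxrank_tr; apply: inj_row_free => v hv.
  apply/rowP => i; rewrite mxE; apply: (hb (fun i => v 0 i)) => s hs.
  rewrite (coord_vbasis hs) alt_suml big1 // => j _.
  rewrite altZl alt_sumr; have /rowP/(_ j) := hv; rewrite !mxE => h.
  suff -> : \sum_i w (vbasis S)`_j (v 0 i *: b i) = 0 by rewrite mulr0.
  by rewrite -[RHS]h; apply: eq_bigr => k _; rewrite altZr !mxE.
have /submxP[D hD] : (\row_i c i <= A)%MS by apply: submx_full.
exists (\sum_j D 0 j *: (vbasis S)`_j).
  by apply: memv_suml => j _; apply: memvZ; apply: vbasis_mem; rewrite mem_nth ?size_tuple.
move=> i; have /rowP/(_ i) := hD; rewrite !mxE => ->.
by rewrite alt_suml; apply: eq_bigr => j _; rewrite altZl mxE.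
Qed.

Definition perp (U : {vspace V}) : {vspace V} :=
  lker (linfun (fun v : V => \row_(i < \dim U) w v (vbasis U)`_i)).

(** [linfun] takes a bare function and computes as that function only once it is packed with a proof
    of linearity. *)
Lemma perp_lfunE (U : {vspace V}) v :
  linfun (fun v : V => \row_(i < \dim U) w v (vbasis U)`_i) v =
  \row_(i < \dim U) w v (vbasis U)`_i.
Proof.
have lin : linear (fun v : V => \row_(i < \dim U) w v (vbasis U)`_i).
  by move=> a x y; apply/rowP => i; rewrite !mxE altDl altZl.
pose ff : {linear V -> 'rV[F]_(\dim U)} :=
  HB.pack (fun v : V => \row_(i < \dim U) w v (vbasis U)`_i)
    (GRing.isLinear.Build _ _ _ _ _ lin).
exact: (lfunE ff).
Qed.

Lemma mem_perp (U : {vspace V}) v : (v \in perp U) <-> (forall u, u \in U -> w v u = 0).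
Proof.
rewrite memv_ker perp_lfunE; split=> [/eqP/rowP h u hu|h].
  rewrite (coord_vbasis hu) alt_sumr big1 // => i _.
  by have := h i; rewrite !mxE altZr => ->; rewrite mulr0.
apply/eqP/rowP => i; rewrite !mxE; apply: h; apply: vbasis_mem.
by rewrite mem_nth ?size_tuple.
Qed.

Lemma pairing_onto_basis (S U : {vspace V}) :
  (forall u, u \in U -> (forall s, s \in S -> w s u = 0) -> u = 0) ->
  forall c : 'I_(\dim U) -> F,
  exists2 s, s \in S & forall i : 'I_(\dim U), w s (vbasis U)`_i = c i.
Proof.
move=> hU; apply: (@pairing_onto S _ (fun i => (vbasis U)`_i)) => c hc.
have /freeP := basis_free (vbasisP U); apply; apply: hU => //.
by apply: memv_suml => j _; apply: memvZ; apply: vbasis_mem; rewrite mem_nth ?size_tuple.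
Qed.

(** Rank-nullity on [S] for the map pairing with a basis of [U]; it is onto because only 0 in [U] is
    orthogonal to all of [S]. *)
Lemma dim_perp (S U : {vspace V}) :
  (forall u, u \in U -> (forall s, s \in S -> w s u = 0) -> u = 0) ->
  (\dim (S :&: perp U) + \dim U = \dim S)%N.
Proof.
move=> hU; rewrite /perp; set L := linfun _.
rewrite -(limg_ker_dim L S); congr (_ + _)%N.
suff -> : (L @: S = fullv)%VS by rewrite dimvf dim_matrix [RHS]mul1n.
apply/eqP; rewrite eqEsubv subvf; apply/subvP => x _.
have [s hs hx] := pairing_onto_basis hU (fun i => x 0 i).
suff -> : x = L s by apply: memv_img.
by apply/rowP => i; rewrite perp_lfunE mxE hx.
Qed.

Lemma mem_perp1 u v : (v \in perp <[u]>) <-> w v u = 0.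
Proof.
rewrite mem_perp; split=> [h|h x /vlineP[a ->]]; first by apply: h; apply: memv_line.
by rewrite altZr h mulr0.
Qed.

Lemma dim_perp1 (S : {vspace V}) u s : s \in S -> w s u = 1 ->
  (\dim (S :&: perp <[u]>)).+1 = \dim S.
Proof.
move=> hs hsu; rewrite -(@dim_perp S <[u]>) => [|x /vlineP[a ->] h].
  rewrite dim_vline -addn1; case: eqP => // u0.
  by move: hsu; rewrite u0 alt0r => /eqP; rewrite eq_sym oner_eq0.
by have := h s hs; rewrite altZr hsu mulr1 => ->; rewrite scale0r.
Qed.

(** [d] is plain equality for a symplectic basis; cut down to the states touching a party, it allows
    one family indexed by all the entangled states. *)
Definition hyperbolic I (e f : I -> V) (d : I -> I -> bool) : Prop :=
  forall i j, [/\ w (e i) (f j) = (d i j)%:R, w (e i) (e j) = 0 & w (f i) (f j) = 0].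

(** Induction on the dimension: if the form is not zero on [U], split off a pair [e], [f] with
    pairing 1. Its orthogonal in [U] has dimension two less and the same radical. *)
Lemma symplectic_basis (U : {vspace V}) :
  exists r (e f : 'I_r -> V),
    [/\ forall i, e i \in U /\ f i \in U,
        hyperbolic e f (fun i j => i == j) &
        \dim U = (r + r + \dim (U :&: perp U))%N].
Proof.
have [m] := ubnP (\dim U); elim: m U => // m IH U /ltnSE hm.
have [/subvP hU|/subvPn[e eU]] := boolP (U <= perp U)%VS.
  exists 0%N, (fun=> 0), (fun=> 0); split; [by case|by case|].
  by rewrite add0n; rewrite (capv_idPl _) //; apply/subvP.
move/negP; rewrite mem_perp => hne.
have [f fU hef] : exists2 f, f \in U & w e f = 1.
  have [h|] := boolP [forall i, w e (vbasis U)`_(i : 'I_(\dim U)) == 0].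
    case: hne => u hu; rewrite (coord_vbasis hu) alt_sumr big1 // => i _.
    by rewrite altZr (eqP (forallP h i)) mulr0.
  rewrite negb_forall => /existsP[i hi]; exists (vbasis U)`_i.
    by apply: vbasis_mem; rewrite mem_nth ?size_tuple.
  by case: (F2P (w e (vbasis U)`_i)) hi => ->; rewrite ?eqxx.
pose U1 := (U :&: perp <[f]>)%VS; pose U2 := (U1 :&: perp <[e]>)%VS.
have d1 : (\dim U1).+1 = \dim U by apply: dim_perp1 eU hef.
have fU1 : f \in U1 by rewrite memv_cap fU; apply/mem_perp1; rewrite alt_xx.
have d2 : (\dim U2).+1 = \dim U1 by apply: dim_perp1 fU1 _; rewrite altC.
have U2P x : x \in U2 <-> [/\ x \in U, w x f = 0 & w x e = 0].
  rewrite !memv_cap; split=> [/andP[/andP[-> /mem_perp1 h] /mem_perp1 h']|[-> h1 h2]] //=.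
  by apply/andP; split; apply/mem_perp1.
have hrad : (U2 :&: perp U2 = U :&: perp U)%VS.
  apply/vspaceP => x; rewrite [LHS]memv_cap [RHS]memv_cap; apply/idP/idP.
    case/andP => /U2P[-> xf xe] /mem_perp h /=; apply/mem_perp => y yU.
    (* The projection of [y] away from the pair lies in [U2], and its pairing with [x] is that of
       [y] since [x] is orthogonal to [e] and [f]. *)
    have /h : y + w y f *: e + w y e *: f \in U2.
      apply/U2P; split; first by rewrite !memvD ?memvZ.
        by rewrite !altDl !altZl hef alt_xx mulr1 mulr0 addr0 F2_addxx.
      by rewrite !altDl !altZl (altC f) hef alt_xx mulr1 mulr0 addr0 F2_addxx.
    by rewrite !altDr !altZr xf xe !mulr0 !addr0.
  case/andP => xU /mem_perp h; apply/andP; split; first by apply/U2P; rewrite !h.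
  by apply/mem_perp => y /U2P[yU _ _]; apply: h.
clearbody U2 U1.
have [|r [e' [f' [hU hh hd]]]] := IH U2; first by lia.
(* The new pair takes index 0 and the pairs of [U2] are shifted by one. *)
exists r.+1, (fun i => if unlift ord0 i is Some j then e' j else e),
  (fun i => if unlift ord0 i is Some j then f' j else f); split.
- move=> i; case: (unliftP ord0 i) => [j _|_]; last by split.
  by have [/U2P[he _ _] /U2P[hf _ _]] := hU j.
- move=> i j; case: (unliftP ord0 i) => [i' ->|->]; case: (unliftP ord0 j) => [j' ->|->].
  + have [-> -> ->] := hh i' j'; by rewrite (inj_eq (@lift_inj _ _)).
  + have [/U2P[_ h1 h2] /U2P[_ h3 h4]] := hU i'.
    by rewrite h1 h2 h3 lift_eqF.
  + have [/U2P[_ h1 h2] /U2P[_ h3 h4]] := hU j'.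
    by rewrite !(altC e) (altC f) h2 h3 h4 eq_liftF.
  by rewrite hef !alt_xx eqxx.
by rewrite -hrad; lia.
Qed.
End AltForm.
End TwoElementField.

(** * Normal form of three alternating forms with zero sum *)

Section TwoElementField2.
Variable F : fieldType.
Hypothesis F2P : forall a : F, a = 0 \/ a = 1.

Section HyperbolicCorrection.
Variables (V : vectType F) (w : V -> V -> F).
Hypothesis hw : altform w.

(** Projection away from the hyperbolic pairs, without signs in characteristic two. That the
    correction stays in [R] lets later arguments bound its effect on the other forms. *)
Lemma gram_schmidt (R : {vspace V}) r (e f : 'I_r -> V) x :
  (forall i, e i \in R /\ f i \in R) -> hyperbolic w e f (fun i j => i == j) ->
  exists2 y, y \in R & forall i, w (x + y) (e i) = 0 /\ w (x + y) (f i) = 0.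
Proof.
move=> hR h; exists (\sum_i (w x (f i) *: e i + w x (e i) *: f i)).
  by apply: memv_suml => i _; have [? ?] := hR i; rewrite memvD ?memvZ.
have hfe i j : w (f i) (e j) = (i == j)%:R.
  by rewrite (altC hw) eq_sym; have [] := h j i.
move=> i; split; rewrite (altDl hw) (alt_suml hw) (bigD1 i) //= big1 => [|j ji].
- rewrite (altDl hw) !(altZl hw) hfe; have [_ -> _] := h i i.
  by rewrite eqxx mulr0 add0r mulr1 addr0 (F2_addxx F2P).
- rewrite (altDl hw) !(altZl hw) hfe; have [_ -> _] := h j i.
  by rewrite (negPf ji) !mulr0 addr0.
- rewrite (altDl hw) !(altZl hw); have [-> _ ->] := h i i.
  by rewrite eqxx mulr0 mulr1 !addr0 (F2_addxx F2P).
- rewrite (altDl hw) !(altZl hw); have [-> _ ->] := h j i.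
  by rewrite (negPf ji) !mulr0 addr0.
Qed.

(** Adding to the [x i] combinations of the dual isotropic family [t], with coefficient matrix [c],
    changes the Gram matrix of [x] by [c + c^T]. *)
Lemma isotropic_correction (R : {vspace V}) p (x t : 'I_p -> V) :
  (forall i, t i \in R) -> (forall i j, w (x i) (t j) = (i == j)%:R) ->
  (forall i j, w (t i) (t j) = 0) ->
  exists2 y : 'I_p -> V, forall i, y i \in R &
    forall i j, w (x i + y i) (x j + y j) = 0.
Proof.
move=> hR hx ht.
(* The strictly upper part [c] of an alternating matrix [m] has [m = c + c^T]. *)
pose c (i j : 'I_p) := if (i < j)%N then w (x i) (x j) else 0.
exists (fun i => \sum_k c i k *: t k).
  by move=> i; apply: memv_suml => k _; apply: memvZ.
have hxt i j : w (x i) (\sum_k c j k *: t k) = c j i.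
  rewrite (alt_sumr hw) (bigD1 i) //= big1 => [|k ki].
    by rewrite (altZr hw) hx eqxx mulr1 addr0.
  by rewrite (altZr hw) hx eq_sym (negPf ki) mulr0.
move=> i j; rewrite (altDl hw) !(altDr hw) hxt (altC hw (\sum_k _) (x j)) hxt.
rewrite [w (\sum_k _) (\sum_k _)](alt_suml hw) [X in _ + (_ + X)]big1 => [|k _]; last first.
  rewrite (altZl hw) (alt_sumr hw) big1 ?mulr0 // => l _.
  by rewrite (altZr hw) ht mulr0.
rewrite addr0 /c; case: ltngtP => [ij|ji|/val_inj ->].
- by rewrite addr0 (altC hw (x j)) (F2_addxx F2P).
- by rewrite addr0 (F2_addxx F2P).
by rewrite (alt_xx hw) !addr0.
Qed.
End HyperbolicCorrection.

(* [wX] is the symplectic form of the restrictions to party X, and its radical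
   [RX] on [S] is the co-local subgroup of X. *)
Record tripartite (V : vectType F) (S : {vspace V}) (wA wB wC : V -> V -> F)
  (RA RB RC : {vspace V}) : Prop := Tripartite {
  tri_altA : altform wA; tri_altB : altform wB; tri_altC : altform wC;
  tri_sum : forall f g, f \in S -> g \in S -> wA f g + wB f g + wC f g = 0;
  tri_radA : forall f, f \in RA <-> f \in S /\ forall g, g \in S -> wA f g = 0;
  tri_radB : forall f, f \in RB <-> f \in S /\ forall g, g \in S -> wB f g = 0;
  tri_radC : forall f, f \in RC <-> f \in S /\ forall g, g \in S -> wC f g = 0;
  tri_disj : forall f, f \in RA -> f \in RB -> f = 0;
  tri_dim : (\dim RA + \dim RB + \dim RC = \dim S)%N }.

Section Tripartite.
Variables (V : vectType F).
Implicit Types (S RA RB RC : {vspace V}) (wA wB wC : V -> V -> F).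

(** Cyclic symmetry, so that each fact is proved for one party only. An element of both [RB] and
    [RC] is also in [RA], because the forms sum to zero. *)
Lemma tri_rot S wA wB wC RA RB RC :
  tripartite S wA wB wC RA RB RC -> tripartite S wB wC wA RB RC RA.
Proof.
case=> hA hB hC h0 rA rB rC hd dm; split=> //.
- by move=> f g fS gS; rewrite addrC addrA h0.
- move=> f fB fC; apply: hd => //; apply/rA.
  have /rB[fS hfB] := fB; have /rC[_ hfC] := fC; split=> // g gS.
  by have := h0 _ _ fS gS; rewrite hfB // hfC // !addr0.
- by rewrite addnC addnA.
Qed.

Section Facts.
Variables (S : {vspace V}) (wA wB wC : V -> V -> F) (RA RB RC : {vspace V}).
Hypothesis T : tripartite S wA wB wC RA RB RC.

Lemma tri_subA f : f \in RA -> f \in S. Proof. by case/(tri_radA T). Qed.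
Lemma tri_zeroA f g : f \in RA -> g \in S -> wA f g = 0.
Proof. by case/(tri_radA T) => _; apply. Qed.
Lemma tri_zeroAr f g : f \in RA -> g \in S -> wA g f = 0.
Proof. by move=> *; rewrite (altC (tri_altA T)) tri_zeroA. Qed.

Lemma tri_eqA f g : f \in RA -> g \in S -> wB f g = wC f g.
Proof.
move=> fA gS; have := tri_sum T (tri_subA fA) gS.
by rewrite tri_zeroA // add0r => /eqP; rewrite addr_eq0 (F2_opp F2P) => /eqP.
Qed.
End Facts.

(** Two of the forms vanish because [f] or [g] is in their radical, and the third because the sum is
    zero. *)
Lemma tri_cross S wA wB wC RA RB RC (T : tripartite S wA wB wC RA RB RC) f g :
  f \in RA -> g \in RB -> [/\ wA f g = 0, wB f g = 0 & wC f g = 0].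
Proof.
have T' := tri_rot T.
move=> fA gB; have gS := tri_subA T' gB; have fS := tri_subA T fA.
have hB := tri_zeroAr T' gB fS; have hA := tri_zeroA T fA gS.
by split=> //; rewrite -(tri_eqA T).
Qed.

(** [RA + RB] is contained in the [wA]-orthogonal of [RC] in [S], and both have dimension
    [\dim S - \dim RC]. The second equation is then the dimension formula for the sum and
    intersection of [RC] and [RA + RB]. *)
Lemma tri_perp S wA wB wC RA RB RC (T : tripartite S wA wB wC RA RB RC) :
  (RC :&: perp wA RC = RC :&: (RA + RB))%VS /\
  (\dim (RC :&: perp wA RC) + \dim (RA + RB + RC) = \dim S)%N.
Proof.
have T' := tri_rot T; have T'' := tri_rot T'.
have hA := tri_altA T.
have hAB : (RA :&: RB = 0)%VS.
  apply/eqP; rewrite -subv0; apply/subvP => x; rewrite memv_cap memv0 => /andP[xA xB].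
  by rewrite (tri_disj T xA xB).
have hP : (RA + RB = S :&: perp wA RC)%VS.
  apply/eqP; rewrite eqEdim; apply/andP; split.
    apply/subvP => _ /memv_addP[a aA [b bB ->]].
    have aS := tri_subA T aA; have bS := tri_subA T' bB.
    rewrite memv_cap memvD //=; apply/(mem_perp hA) => c cC.
    have [h _ _] := tri_cross T'' cC aA; have [_ _ h'] := tri_cross T' bB cC.
    by rewrite (altDl hA) h' (tri_zeroA T) ?addr0 // (tri_subA T'').
  have := @dim_perp _ _ _ hA S RC; rewrite dimv_disjoint_sum // => hd.
  have := tri_dim T; rewrite -hd => [|u uC hu]; first by rewrite leq_eqVlt => /addIn ->; rewrite eqxx.
  apply: (tri_disj T'') => //; apply/(tri_radA T); split; first exact: (tri_subA T'' uC).
  by move=> s sS; rewrite (altC hA) hu.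
have hS : (RC <= S)%VS by apply/subvP => x; exact: (tri_subA T'').
have hK : (RC :&: perp wA RC = RC :&: (RA + RB))%VS.
  by rewrite hP capvA (capv_idPl hS).
split=> //; rewrite hK capvC addnC dimv_sum_cap -(tri_dim T).
by rewrite (dimv_disjoint_sum hAB).
Qed.

(* The entangled states of the target: Bell pairs AB, CA, BC, and GHZ states, in
   this order. *)
Definition edge (kA kB kC p : nat) : finType := ('I_kC + 'I_kB + 'I_kA + 'I_p)%type.

Definition touchA kA kB kC p (k : edge kA kB kC p) :=
  if k is inl (inr _) then false else true.
Definition touchB kA kB kC p (k : edge kA kB kC p) :=
  if k is inl (inl (inr _)) then false else true.
Definition touchC kA kB kC p (k : edge kA kB kC p) :=
  if k is inl (inl (inl _)) then false else true.

Definition on_edge T kA kB kC p (c : 'I_kC -> T) (b : 'I_kB -> T) (a : 'I_kA -> T)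
  (g : 'I_p -> T) (k : edge kA kB kC p) : T :=
  match k with
  | inl (inl (inl i)) => c i
  | inl (inl (inr i)) => b i
  | inl (inr i) => a i
  | inr i => g i
  end.

(* [X k] is the all-[x] stabilizer of the state [k], and [ZX k] an element of [V]
   whose restriction to party X is the [z] operator of the qubit of [k] at X. *)
Lemma tri_normal_form S wA wB wC RA RB RC :
  tripartite S wA wB wC RA RB RC ->
  exists p kA kB kC (X ZA ZB ZC : edge kA kB kC p -> V),
    [/\ [/\ p = (\dim S - \dim (RA + RB + RC))%N, \dim RA = (kA + kA + p)%N,
            \dim RB = (kB + kB + p)%N & \dim RC = (kC + kC + p)%N],
        [/\ hyperbolic wA X ZA (fun k l => (k == l) && touchA k),
            hyperbolic wB X ZB (fun k l => (k == l) && touchB k) &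
            hyperbolic wC X ZC (fun k l => (k == l) && touchC k)],
        forall k, [/\ X k \in S, ~~ touchA k -> X k \in RA /\ ZA k = 0,
            ~~ touchB k -> X k \in RB /\ ZB k = 0 &
            ~~ touchC k -> X k \in RC /\ ZC k = 0] &
        forall k, [/\ touchA k && touchB k ->
                        exists2 z, z \in RC & ZA k - z \in RA /\ ZB k - z \in RB,
                      touchA k && touchC k ->
                        exists2 z, z \in RB & ZA k - z \in RA /\ ZC k - z \in RC &
                      touchB k && touchC k ->
                        exists2 z, z \in RA & ZB k - z \in RB /\ ZC k - z \in RC]].
Proof.
move=> T; have T' := tri_rot T; have T'' := tri_rot T'.
have [hA hB hC] : [/\ altform wA, altform wB & altform wC] by case: T.
have [sA sB sC] : [/\ forall f, f \in RA -> f \in S, forall f, f \in RB -> f \in S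
    & forall f, f \in RC -> f \in S].
  by split; [exact: (tri_subA T)|exact: (tri_subA T')|exact: (tri_subA T'')].
have cAB := tri_cross T; have cBC := tri_cross T'; have cCA := tri_cross T''.
have [KC dKC] := tri_perp T; have [KA dKA] := tri_perp T'; have [KB dKB] := tri_perp T''.
(* On [RC] the forms [wA] and [wB] agree, so a hyperbolic pair there is the XX and ZZ of a Bell pair
   of A and B; the other two cases are cyclic. *)
have [kC [eC [fC [RefC hypC dC]]]] := symplectic_basis F2P hA RC.
have [kA [eA [fA [RefA hypA dA]]]] := symplectic_basis F2P hB RA.
have [kB [eB [fB [RefB hypB dB]]]] := symplectic_basis F2P hC RB.
rewrite [(RB + RC + RA)%VS]addvC addvA in dKA.
have e2 : (RC + RA + RB = RA + RB + RC)%VS by rewrite -addvA addvC.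
rewrite e2 in dKB.
set K := (RC :&: perp wA RC)%VS in KC dKC dC.
pose p := \dim K.
(* Each of the three radicals has the dimension missing from [RA + RB + RC] in [S], which is
   symmetric in the parties. *)
have pA : \dim (RA :&: perp wB RA) = p by apply/eqP; rewrite -(eqn_add2r (\dim (RA + RB + RC))) dKA dKC.
have pB : \dim (RB :&: perp wC RB) = p by apply/eqP; rewrite -(eqn_add2r (\dim (RA + RB + RC))) dKB dKC.
rewrite pA in dA; rewrite pB in dB.
pose tC (i : 'I_p) := (vbasis K)`_i.
have tK i : tC i \in K by apply: vbasis_mem; rewrite mem_nth ?size_tuple.
have KP y : y \in K <-> y \in RC /\ forall c, c \in RC -> wA y c = 0.
  rewrite memv_cap; split=> [/andP[-> /(mem_perp hA) h]|[-> /(mem_perp hA) ->]] //.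
have tRC i : tC i \in RC by have /KP[] := tK i.
have /fin_all_exists[t ht] : forall i, exists t : V * V,
    [/\ t.1 \in RA, t.2 \in RB & tC i = t.1 + t.2].
  move=> i.
  have := tK i; rewrite KC memv_cap => /andP[_ /memv_addP[a aA [b bB ->]]].
  by exists (a, b).
pose tA i := (t i).1; pose tB i := (t i).2.
have tRA i : tA i \in RA by have [] := ht i.
have tRB i : tB i \in RB by have [] := ht i.
have tE i : tC i = tA i + tB i by have [] := ht i.
clearbody tA tB; clear t ht.
have tKB i : tB i \in (RB :&: perp wC RB)%VS.
  rewrite KB memv_cap tRB addvC; apply/memv_addP; exists (tA i) => //; exists (tC i) => //.
  by rewrite tE addrA (F2_addv F2P) add0r.
(* Adding a [small] element preserves [good], the orthogonality to all hyperbolic pairs. The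
   radicals of [RC] and of [RB] consist of such elements, so both later corrections are harmless. *)
pose small y := [/\ y \in S, forall c, c \in RC -> wA y c = 0,
  forall b, b \in RB -> wC y b = 0 & forall a, a \in RA -> wB y a = 0].
have smallC y : y \in K -> small y.
  case/KP => yC h; split=> [|//|b bB|a aA]; first exact: sC.
    by rewrite (tri_zeroA T'') // sB.
  by have [] := cCA _ _ yC aA.
have smallB y : y \in (RB :&: perp wC RB)%VS -> small y.
  rewrite memv_cap => /andP[yB /(mem_perp hC) h]; split=> [|c cC|//|a aA]; first exact: sB.
    by have [] := cBC _ _ yB cC.
  by rewrite (tri_zeroA T') // sA.
pose good x := [/\ x \in S, forall i, wA x (eC i) = 0 /\ wA x (fC i) = 0,
  forall i, wC x (eB i) = 0 /\ wC x (fB i) = 0 &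
  forall i, wB x (eA i) = 0 /\ wB x (fA i) = 0].
have goodD x y : good x -> small y -> good (x + y).
  case=> xS gC gB gA [yS h1 h2 h3]; split; first exact: memvD.
  - by move=> i; have [? ?] := RefC i; have [? ?] := gC i; split; rewrite (altDl hA) h1 // addr0.
  - by move=> i; have [? ?] := RefB i; have [? ?] := gB i; split; rewrite (altDl hC) h2 // addr0.
  - by move=> i; have [? ?] := RefA i; have [? ?] := gA i; split; rewrite (altDl hB) h3 // addr0.
have sumA f g : f \in S -> g \in S -> wB f g = 0 -> wC f g = 0 -> wA f g = 0.
  by move=> fS gS h1 h2; have := tri_sum T fS gS; rewrite h1 h2 !addr0.
have /fin_all_exists[x0 hx0] : forall j, exists x : V,
    good x /\ forall i, wA x (tC i) = (j == i)%:R.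
  move=> j.
  (* Dual elements exist: an element of [K] that is [wA]-orthogonal to [S] would lie in both [RC]
     and [RA]. *)
  have [|x xS hx] := @pairing_onto_basis _ _ _ hA S K _ (fun i => (j == i)%:R).
    move=> u /KP[uC _] h; apply: (tri_disj T'') => //; apply/(tri_radA T); split; first exact: sC.
    by move=> s sS; rewrite (altC hA) h.
  (* Three successive projections. Each correction lies in one radical, so it disturbs neither the
     orthogonality already reached nor the pairings with [tC]. *)
  have [y1 y1C h1] := gram_schmidt hA x RefC hypC.
  have [y2 y2B h2] := gram_schmidt hC (x + y1) RefB hypB.
  have [y3 y3A h3] := gram_schmidt hB (x + y1 + y2) RefA hypA.
  have BCA b c : b \in RB -> c \in RC -> wA b c = 0 by move=> hb hc; have [] := cBC _ _ hb hc.
  have AA a s : a \in RA -> s \in S -> wA a s = 0 by exact: (tri_zeroA T).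
  have ABC a b : a \in RA -> b \in RB -> wC a b = 0 by move=> ha hb; have [] := cAB _ _ ha hb.
  exists (x + y1 + y2 + y3); split; first split.
  - by rewrite !memvD ?(sA y3) ?(sB y2) ?(sC y1).
  - move=> i; have [? ?] := RefC i; have [? ?] := h1 i.
    by split; rewrite (altDl hA) (altDl hA _ y2) [wA y2 _]BCA ?[wA y3 _]AA ?addr0 ?sC.
  - move=> i; have [? ?] := RefB i; have [? ?] := h2 i.
    by split; rewrite (altDl hC) [wC y3 _]ABC ?addr0.
  - exact: h3.
  move=> i; rewrite 3!(altDl hA) hx [wA y2 _]BCA ?[wA y3 _]AA ?addr0 ?sC //.
  by have /KP[_ h] := tK i; rewrite (altC hA) h // addr0.
have ttC i j : wB (tC i) (tC j) = 0.
  rewrite -(tri_eqA T'') ?sC //; have /KP[_ ->] := tK i => //.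
have x0S i : x0 i \in S by have [[]] := hx0 i.
(* First correction, for [wB]: since [tC] is in [RC], its [wB]-pairings with the [x0] are its
   [wA]-pairings, hence dual. *)
have [y yK hy] := @isotropic_correction _ _ hB K _ x0 tC tK
  (fun i j => etrans (altC hB _ _) (etrans (esym (tri_eqA T'' (tRC j) (x0S i)))
     (etrans (altC hA _ _) ((hx0 i).2 j)))) ttC.
pose x1 i := x0 i + y i.
have gx1 i : good (x1 i) by apply: goodD; [have [] := hx0 i|apply: smallC].
have x1S i : x1 i \in S by have [] := gx1 i.
have dx1 i j : wA (x1 i) (tC j) = (i == j)%:R.
  by rewrite /x1 (altDl hA) (hx0 i).2; have /smallC[_ -> //] := yK i; rewrite addr0.
have tBE i : tB i = tC i + tA i by rewrite tE addrAC (F2_addv F2P) add0r.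
(* On [RB] the form [wC] agrees with [wA], and [tB] differs from [tC] by [tA], which is in the
   radical of [wA]. *)
have x1B i j : wC (x1 i) (tB j) = (i == j)%:R.
  rewrite (altC hC) (tri_eqA T') // (altC hA) tBE (altDr hA) dx1.
  by rewrite (tri_zeroAr T) // addr0.
have ttB i j : wC (tB i) (tB j) = 0 by have /smallB[_ _ -> //] := tKB i.
(* Second correction, for [wC]: it lies in [RB], the radical of [wB], so the vanishing of [wB]
   persists; [wA] then vanishes as the sum of the other two. *)
have [z zK hz] := isotropic_correction hC tKB x1B ttB.
pose x i := x1 i + z i.
have gx i : good (x i) by apply: goodD; last apply: smallB.
have xS i : x i \in S by have [] := gx i.
have zR i : z i \in RB by have := zK i; rewrite memv_cap => /andP[].
have dxC i j : wA (x i) (tC j) = (i == j)%:R.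
  by rewrite /x (altDl hA) dx1; have /smallB[_ -> //] := zK i; rewrite addr0.
(* As soon as one argument lies in a radical, a single form decides the vanishing of all three. The
   facts below tabulate [Z] for all pairs of chosen elements. *)
pose Z u v := [/\ wA u v = 0, wB u v = 0 & wC u v = 0].
have Zs u v : Z u v -> Z v u.
  by case=> h1 h2 h3; split; rewrite ?(altC hA v) ?(altC hB v) ?(altC hC v).
have ZRA u v : u \in RA -> v \in S -> wB u v = 0 -> Z u v.
  by move=> uA vS h; split; rewrite -?(tri_eqA T) // (tri_zeroA T).
have ZRB u v : u \in RB -> v \in S -> wC u v = 0 -> Z u v.
  by move=> uB vS h; split; rewrite -?(tri_eqA T') // (tri_zeroA T').
have ZRC u v : u \in RC -> v \in S -> wA u v = 0 -> Z u v.
  by move=> uC vS h; split; rewrite -?(tri_eqA T'') // (tri_zeroA T'').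
have [eCR fCR] : (forall i, eC i \in RC) /\ (forall i, fC i \in RC) by split=> i; case: (RefC i).
have [eAR fAR] : (forall i, eA i \in RA) /\ (forall i, fA i \in RA) by split=> i; case: (RefA i).
have [eBR fBR] : (forall i, eB i \in RB) /\ (forall i, fB i \in RB) by split=> i; case: (RefB i).
have ZAB u v : u \in RA -> v \in RB -> Z u v by exact: cAB.
have ZBC u v : u \in RB -> v \in RC -> Z u v by move=> hu hv; have [] := cBC _ _ hu hv.
have ZCA u v : u \in RC -> v \in RA -> Z u v by move=> hu hv; have [] := cCA _ _ hu hv.
have ZBA u v : u \in RB -> v \in RA -> Z u v by move=> *; apply: Zs; apply: ZAB.
have ZCB u v : u \in RC -> v \in RB -> Z u v by move=> *; apply: Zs; apply: ZBC.
have ZAC u v : u \in RA -> v \in RC -> Z u v by move=> *; apply: Zs; apply: ZCA.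
have ZeeC i j : Z (eC i) (eC j) by apply: ZRC; rewrite ?sC //; have [] := hypC i j.
have ZffC i j : Z (fC i) (fC j) by apply: ZRC; rewrite ?sC //; have [] := hypC i j.
have ZeeA i j : Z (eA i) (eA j) by apply: ZRA; rewrite ?sA //; have [] := hypA i j.
have ZffA i j : Z (fA i) (fA j) by apply: ZRA; rewrite ?sA //; have [] := hypA i j.
have ZeeB i j : Z (eB i) (eB j) by apply: ZRB; rewrite ?sB //; have [] := hypB i j.
have ZffB i j : Z (fB i) (fB j) by apply: ZRB; rewrite ?sB //; have [] := hypB i j.
have ZxeC i j : Z (eC j) (x i).
  by apply: ZRC => //; rewrite (altC hA); have [_ /(_ j)[]] := gx i.
have ZxfC i j : Z (fC j) (x i).
  by apply: ZRC => //; rewrite (altC hA); have [_ /(_ j)[]] := gx i.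
have ZxeB i j : Z (eB j) (x i).
  by apply: ZRB => //; rewrite (altC hC); have [_ _ /(_ j)[]] := gx i.
have ZxfB i j : Z (fB j) (x i).
  by apply: ZRB => //; rewrite (altC hC); have [_ _ /(_ j)[]] := gx i.
have ZxeA i j : Z (eA j) (x i).
  by apply: ZRA => //; rewrite (altC hB); have [_ _ _ /(_ j)[]] := gx i.
have ZxfA i j : Z (fA j) (x i).
  by apply: ZRA => //; rewrite (altC hB); have [_ _ _ /(_ j)[]] := gx i.
have ZtC i v : v \in RC -> Z (tC i) v.
  by move=> vC; apply: ZRC; rewrite ?sC //; have /KP[_ ->] := tK i.
have ZtB i v : v \in RB -> Z (tB i) v.
  by move=> vB; apply: ZRB; rewrite ?sB //; have /smallB[_ _ ->] := tKB i.
have Zxx i j : Z (x i) (x j).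
  have hxB : wB (x i) (x j) = 0.
    rewrite (altDl hB) (tri_zeroA T' (zR i)) // addr0.
    by rewrite (altDr hB) (tri_zeroAr T' (zR j)) // addr0; apply: hy.
  have hxC : wC (x i) (x j) = 0 by apply: hz.
  by split=> //; apply: sumA.
have Z0 u : Z u 0 by split; rewrite ?(alt0r hA) ?(alt0r hB) ?(alt0r hC).
have Z1 u v : Z u v -> wA u v = 0 by case.
have Z2 u v : Z u v -> wB u v = 0 by case.
have Z3 u v : Z u v -> wC u v = 0 by case.
have dCB i j : wB (eC i) (fC j) = (i == j)%:R.
  by rewrite -(tri_eqA T'') ?sC //; have [-> _ _] := hypC i j.
have dAC i j : wC (eA i) (fA j) = (i == j)%:R.
  by rewrite -(tri_eqA T) ?sA //; have [-> _ _] := hypA i j.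
have dBA i j : wA (eB i) (fB j) = (i == j)%:R.
  by rewrite -(tri_eqA T') ?sB //; have [-> _ _] := hypB i j.
have dxB i j : wB (x i) (tC j) = (i == j)%:R.
  by rewrite (altC hB) -(tri_eqA T'') // (altC hA) dxC.
have dxD i j : wC (x i) (tB j) = (i == j)%:R.
  by rewrite (altDl hC) x1B; have /smallB[_ _ -> //] := zK i; rewrite addr0.
have dCA i j : wA (eC i) (fC j) = (i == j)%:R by have [] := hypC i j.
have dAB i j : wB (eA i) (fA j) = (i == j)%:R by have [] := hypA i j.
have dBC i j : wC (eB i) (fB j) = (i == j)%:R by have [] := hypB i j.
pose X := @on_edge V kA kB kC p eC eB eA x.
(* [tC] is in [RC], so the GHZ [z] operator at C must come from [tB]. The ZZ stabilizers of a GHZ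
   state are then [tC] on A and B, [tB] on A and C, and [tA] on B and C. *)
pose ZA := @on_edge V kA kB kC p fC fB (fun=> 0) tC.
pose ZB := @on_edge V kA kB kC p fC (fun=> 0) fA tC.
pose ZC := @on_edge V kA kB kC p (fun=> 0) fB fA tB.
clear ZRA ZRB ZRC.
have HA : hyperbolic wA X ZA (fun k l => (k == l) && touchA k).
  by move=> [[[i|i]|i]|i] [[[j|j]|j]|j] /=; rewrite ?andbF ?andbT; split;
    first [exact: dCA | exact: dBA | exact: dxC | apply: Z1; auto 4].
have HB : hyperbolic wB X ZB (fun k l => (k == l) && touchB k).
  by move=> [[[i|i]|i]|i] [[[j|j]|j]|j] /=; rewrite ?andbF ?andbT; split;
    first [exact: dCB | exact: dAB | exact: dxB | apply: Z2; auto 4].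
have HC : hyperbolic wC X ZC (fun k l => (k == l) && touchC k).
  by move=> [[[i|i]|i]|i] [[[j|j]|j]|j] /=; rewrite ?andbF ?andbT; split;
    first [exact: dAC | exact: dBC | exact: dxD | apply: Z3; auto 4].
exists p, kA, kB, kC, X, ZA, ZB, ZC.
split=> //.
- by split=> //; rewrite -dKC addnK.
- case=> [[[i|i]|i]|i] /=; split=> //.
  by apply: sC. by apply: sB. by apply: sA.
- case=> [[[i|i]|i]|i] /=; split=> // _.
  + by exists (fC i); rewrite ?subrr ?mem0v.
  + by exists (fB i); rewrite ?subrr ?mem0v.
  + by exists (fA i); rewrite ?subrr ?mem0v.
  + by exists (tC i); rewrite ?subrr ?mem0v.
  + exists (tB i) => //; rewrite subrr mem0v; split=> //.
    by rewrite (F2_oppv F2P) tE -addrA (F2_addv F2P) addr0.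
  exists (tA i) => //; rewrite !(F2_oppv F2P) tE; split.
    by rewrite addrAC (F2_addv F2P) add0r.
  by rewrite addrC -tE.
Qed.
End Tripartite.
End TwoElementField2.

(** * Pauli operators as matrices *)

Lemma F2_cases (a : 'F_2) : a = 0 \/ a = 1.
Proof. by case: a => [[|[|//]] ?]; [left|right]; apply: val_inj. Qed.

Lemma F2_neq0D (a b : 'F_2) : (a + b != 0) = (a != 0) (+) (b != 0).
Proof. by case: (F2_cases a) (F2_cases b) => -> [] ->. Qed.

Lemma F2_neq0M (a b : 'F_2) : (a * b != 0) = (a != 0) && (b != 0).
Proof. by case: (F2_cases a) (F2_cases b) => -> [] ->. Qed.

Section Quantum.
Variable C : numClosedFieldType.

Definition sgn (a : 'F_2) : C := (-1) ^+ (a != 0).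

Lemma sgnD a b : sgn (a + b) = sgn a * sgn b.
Proof. by rewrite /sgn F2_neq0D; do 2!case: (_ != 0); rewrite /= ?mulr1 ?mul1r ?mulrNN ?mulr1. Qed.

Lemma sgn0 : sgn 0 = 1. Proof. by rewrite /sgn eqxx. Qed.
Lemma sgn1 : sgn 1 = -1. Proof. by rewrite /sgn oner_eq0. Qed.

Lemma sgnMsgn a : sgn a * sgn a = 1.
Proof. by rewrite -expr2 /sgn sqrr_sign. Qed.

Lemma sgn_sum k (a : 'I_k -> 'F_2) : sgn (\sum_j a j) = \prod_j sgn (a j).
Proof. by apply: (big_morph sgn sgnD sgn0). Qed.

(** Operators indexed by basis states become ordinary matrices through an enumeration of the basis,
    which gives access to matrix algebra. *)
Definition mxop (T : finType) (U : T -> T -> C) : 'M[C]_#|T| :=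
  \matrix_(i, j) U (enum_val i) (enum_val j).

Definition opmx (T : finType) (M : 'M[C]_#|T|) : T -> T -> C :=
  fun x y => M (enum_rank x) (enum_rank y).

Lemma opmxK T : cancel (@opmx T) (@mxop T).
Proof. by move=> M; apply/matrixP => i j; rewrite mxE /opmx !enum_valK. Qed.

Lemma mxopK T : cancel (@mxop T) (@opmx T).
Proof.
move=> U; apply: functional_extensionality => x; apply: functional_extensionality => y.
by rewrite /opmx mxE !enum_rankK.
Qed.

Lemma mxop_inj T : injective (@mxop T). Proof. exact: can_inj (@mxopK T). Qed.

Lemma mxopM (T : finType) (U W : T -> T -> C) :
  mxop (fun x z => \sum_y U x y * W y z) = mxop U *m mxop W.
Proof.
apply/matrixP => i j; rewrite !mxE (reindex (@enum_val T T)) /=; last first.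
  by apply: onW_bij; apply: enum_val_bij.
by apply: eq_bigr => k _; rewrite !mxE.
Qed.

Lemma mxop_id (T : finType) : mxop (fun x y : T => (x == y)%:R) = 1%:M.
Proof. by apply/matrixP => i j; rewrite !mxE (inj_eq enum_val_inj). Qed.

Definition hc m n (M : 'M[C]_(m, n)) : 'M_(n, m) := map_mx Num.conj M^T.

Lemma hcM m n p (M : 'M_(m, n)) (N : 'M_(n, p)) : hc (M *m N) = hc N *m hc M.
Proof. by rewrite /hc trmx_mul map_mxM. Qed.

Lemma hcZ m n a (M : 'M_(m, n)) : hc (a *: M) = a^* *: hc M.
Proof. by rewrite /hc linearZ /= map_mxZ. Qed.

Lemma hcK m n (M : 'M_(m, n)) : hc (hc M) = M.
Proof. by apply/matrixP => i j; rewrite !mxE conjCK. Qed.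

Lemma mxop_adj k (U : op C k) : mxop (adj U) = hc (mxop U).
Proof. by apply/matrixP => i j; rewrite !mxE. Qed.

Lemma sigma1_adj a b r s : (sigma1 C a b r s)^* = sigma1 C a b s r.
Proof.
by case: a b r s => [] [] [] []; rewrite /sigma1 /= ?(conjC0, conjC1, rmorphN, conjCi, opprK) /= ?(conjC1, conjCi, opprK).
Qed.

Lemma sigma1_mul a b c d : exists u : C, forall r s,
  sigma1 C (a (+) c) (b (+) d) r s =
  u * \sum_t sigma1 C a b r t * sigma1 C c d t s.
Proof.
(* The phases come from [sigma^y = i sigma^x sigma^z] and the other products of two distinct Pauli
   matrices. *)
exists (match a, b, c, d with
  | true, false, false, true => 'i | false, true, true, false => - 'i
  | true, false, true, true => - 'i | true, true, true, false => 'i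
  | false, true, true, true => 'i | true, true, false, true => - 'i
  | _, _, _, _ => 1 end) => r s.
rewrite big_bool; have ii : 'i * 'i = -1 :> C by rewrite -expr2 sqrCi.
by case: a b c d r s => [] [] [] [] [] []; rewrite /sigma1 /= ?(mulrN, mulNr, mulr0, mul0r, mulr1, mul1r, addr0, add0r, opprK, oppr0, ii).
Qed.

Lemma sigma1_comm a b c d r s :
  \sum_t sigma1 C a b r t * sigma1 C c d t s =
  (-1) ^+ ((a && d) (+) (b && c)) * \sum_t sigma1 C c d r t * sigma1 C a b t s.
Proof.
rewrite !big_bool.
by case: a b c d r s => [] [] [] [] [] []; rewrite /sigma1 /= ?(expr0, expr1, mulrN, mulNr, mulr0, mul0r, mulr1, mul1r, addr0, add0r, opprK, oppr0).
Qed.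

Lemma sigma1_sq a b r s :
  \sum_t sigma1 C a b r t * sigma1 C a b t s = (r == s)%:R.
Proof.
rewrite !big_bool; have ii : 'i * 'i = -1 :> C by rewrite -expr2 sqrCi.
by case: a b r s => [] [] [] []; rewrite /sigma1 /= ?(expr0, expr1, mulrN, mulNr, mulr0, mul0r, mulr1, mul1r, addr0, add0r, opprK, oppr0, ii).
Qed.

(** The sum over intermediate bit strings distributes over the qubits, which reduces Pauli
    identities to the one-qubit tables above. *)
Lemma opmul_sigma k (f g : G k) x z :
  opmul (sigma C f) (sigma C g) x z =
  \prod_j \sum_t sigma1 C (f.1 0 j != 0) (f.2 0 j != 0) (x j) t *
                 sigma1 C (g.1 0 j != 0) (g.2 0 j != 0) t (z j).
Proof.
rewrite bigA_distr_bigA /opmul; apply: eq_bigr => y _.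
by rewrite big_split.
Qed.

Lemma prod_nat_eq (I : finType) (P : pred I) :
  \prod_(i : I) (P i)%:R = [forall i, P i]%:R :> C.
Proof.
have [/forallP h|] := boolP [forall i, P i]; first by rewrite big1 // => i _; rewrite h.
rewrite negb_forall => /existsP[i hi]; apply/eqP; rewrite (bigD1 i) //= (negPf hi).
by rewrite mul0r.
Qed.

Lemma bits_eq k (x y : bits k) : (x == y) = [forall j, x j == y j].
Proof. by apply/eqP/forallP => [-> //|h]; apply/ffunP => j; apply/eqP. Qed.

Definition pauli k (f : G k) : 'M[C]_#|bits k| := mxop (sigma C f).

Lemma pauli_adj k (f : G k) : hc (pauli f) = pauli f.
Proof.
apply/matrixP => i j; rewrite !mxE /sigma rmorph_prod.
by apply: eq_bigr => l _; apply: sigma1_adj.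
Qed.

Lemma pauli_sq k (f : G k) : pauli f *m pauli f = 1%:M.
Proof.
rewrite -mxopM -mxop_id; congr mxop.
apply: functional_extensionality => x; apply: functional_extensionality => y.
rewrite [LHS]opmul_sigma (eq_bigr (fun j => (x j == y j)%:R)) => [|j _]; last exact: sigma1_sq.
by rewrite prod_nat_eq -bits_eq.
Qed.

Lemma pauli_comm k (f g : G k) :
  pauli f *m pauli g = sgn (sympl f g) *: (pauli g *m pauli f).
Proof.
rewrite -!mxopM; apply/matrixP => i j; rewrite !mxE.
rewrite [LHS]opmul_sigma [X in _ = _ * X]opmul_sigma /sympl sgn_sum -big_split /=.
apply: eq_bigr => l _; rewrite sigma1_comm; congr (_ * _).
by rewrite /sgn F2_neq0D !F2_neq0M.
Qed.

Lemma pauliD k (f g : G k) :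
  exists u : C, pauli (f + g) = u *: (pauli f *m pauli g).
Proof.
have /fin_all_exists[u hu] : forall j : 'I_k, exists u : C, forall r s,
  sigma1 C ((f + g).1 0 j != 0) ((f + g).2 0 j != 0) r s = u *
   \sum_t sigma1 C (f.1 0 j != 0) (f.2 0 j != 0) r t *
                 sigma1 C (g.1 0 j != 0) (g.2 0 j != 0) t s.
  by move=> j; rewrite !mxE !F2_neq0D; apply: sigma1_mul.
exists (\prod_j u j); rewrite -mxopM; apply/matrixP => i j; rewrite !mxE.
rewrite [X in _ = _ * X]opmul_sigma -big_split /=.
by apply: eq_bigr => l _; rewrite hu.
Qed.

Lemma pauli0 k : pauli (0 : G k) = 1%:M.
Proof.
rewrite -mxop_id; apply/matrixP => i j; rewrite !mxE bits_eq -prod_nat_eq.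
by apply: eq_bigr => l _; rewrite !mxE eqxx.
Qed.

Lemma mx_bits_neq0 k : (1%:M : 'M[C]_#|bits k|) != 0.
Proof.
apply/eqP => /matrixP/(_ (enum_rank [ffun=> false]) (enum_rank [ffun=> false])) /eqP.
by rewrite !mxE eqxx oner_eq0.
Qed.
End Quantum.

(** * Intertwiners *)

(** Induction on the number of true bits, clearing one of them at each step. *)
Lemma flip_invariant (T : finType) A (g : {ffun T -> bool} -> A) :
  (forall i (x : {ffun T -> bool}), g [ffun j => x j (+) (j == i)] = g x) -> forall x, g x = g [ffun=> false].
Proof.
move=> hg x; have [m] := ubnP #|[set i | x i]|; elim: m x => // m IH x /ltnSE hm.
have [/existsP[i hi]|h] := boolP [exists i, x i]; last first.
  congr g; apply/ffunP => i; rewrite ffunE; apply/negbTE.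
  by apply: contra h => hi; apply/existsP; exists i.
rewrite -(hg i) IH //; apply: leq_trans hm; apply: proper_card; apply/properP; split.
  by apply/subsetP => j; rewrite !inE ffunE; case: eqP => [->|_]; rewrite ?hi ?addbF.
by exists i; rewrite !inE ?ffunE ?hi ?eqxx.
Qed.

(* Project onto the +1 eigenspace of one [L i] at a time; when the projection
   vanishes, [J i] exchanges the two eigenspaces of [L i] and no others. *)
Lemma joint_fixed_vector (V : zmodType) (I : finType) (L J : I -> V -> V) (v0 : V) :
  v0 != 0 ->
  (forall i u v, L i (u + v) = L i u + L i v) -> (forall i v, L i (L i v) = v) ->
  (forall i j v, L i (L j v) = L j (L i v)) ->
  (forall i v, J i v = 0 -> v = 0) ->
  (forall i v, L i (J i v) = J i (- L i v)) ->
  (forall i j v, j != i -> L j (J i v) = J i (L j v)) ->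
  exists2 v, v != 0 & forall i, L i v = v.
Proof.
move=> v0n0 LD LK LC J0 LJ LJ'.
suff [v hv h] : exists2 v, v != 0 & forall i, i \in enum I -> L i v = v.
  by exists v => // i; apply: h; rewrite mem_enum.
elim: (enum I) => [|i s [v hv h]]; first by exists v0.
have [us|us] := boolP (i \in s).
  by exists v => // j; rewrite inE => /predU1P[->|]; apply: h.
have [h0|h0] := eqVneq (v + L i v) 0; last first.
  exists (v + L i v) => // j; rewrite inE LD => /predU1P[->|js].
    by rewrite LK addrC.
  by rewrite LC h.
exists (J i v); first by apply: contra hv => /eqP /J0 ->.
move=> j; rewrite inE => /predU1P[->|js].
  by rewrite LJ; congr J; apply/eqP; rewrite eq_sym -addr_eq0 h0.
by rewrite LJ' ?h //; apply: contra us => /eqP <-.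
Qed.

Section Sympl.
Variable k : nat.

Lemma symplC (f g : G k) : sympl f g = sympl g f.
Proof. by apply: eq_bigr => j _; rewrite addrC [f.1 _ _ * _]mulrC [f.2 _ _ * _]mulrC. Qed.

(** A predicate covers both uses: [pred1 i] for the standard generators, and the set of qubits of
    one party belonging to a given entangled state. *)
Definition rowb (P : pred 'I_k) : 'rV['F_2]_k := \row_j (P j)%:R.
Definition genX (P : pred 'I_k) : G k := (rowb P, 0).
Definition genZ (P : pred 'I_k) : G k := (0, rowb P).

Lemma rowb_neq0 P j : (rowb P 0 j != 0) = P j.
Proof. by rewrite mxE; case: (P j). Qed.

Lemma sympl_XX P Q : sympl (genX P) (genX Q) = 0.
Proof. by rewrite /sympl big1 // => j _; rewrite !mxE mulr0 mul0r addr0. Qed.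

Lemma sympl_ZZ P Q : sympl (genZ P) (genZ Q) = 0.
Proof. by rewrite /sympl big1 // => j _; rewrite !mxE mulr0 mul0r addr0. Qed.

Lemma sympl_XZ i j : sympl (genX (pred1 i)) (genZ (pred1 j)) = (i == j)%:R.
Proof.
rewrite /sympl (bigD1 i) //= big1 => [|l li]; rewrite !mxE /= ?eqxx ?(negPf li).
  by rewrite mul1r mul0r !addr0.
by rewrite !mul0r addr0.
Qed.
End Sympl.

Section Quantum.
Variable C : numClosedFieldType.

Lemma sigma_X k (P : pred 'I_k) x y :
  sigma C (genX P) x y = (y == [ffun j => x j (+) P j])%:R.
Proof.
rewrite bits_eq -prod_nat_eq; apply: eq_bigr => j _; rewrite rowb_neq0 mxE eqxx ffunE /=.
by case: (P j) (x j) (y j) => [] [] [].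
Qed.

Lemma sigma_Z k (P : pred 'I_k) x y :
  sigma C (genZ P) x y = (x == y)%:R * \prod_j (-1) ^+ (P j && x j).
Proof.
rewrite bits_eq -prod_nat_eq -big_split; apply: eq_bigr => j _ /=; rewrite rowb_neq0 mxE eqxx /=.
by case: (P j) (x j) (y j) => [] [] []; rewrite /sigma1 /= ?expr0 ?expr1 ?mulr1 ?mul1r ?mul0r.
Qed.

(** The maps sending [M] to [r i] times [P(a i) M P(b i)] are involutions, and they commute because
    the signs from the [a] and from the [b] cancel. Left multiplication by [P(c i)] anticommutes
    with the [i]-th map only, so [joint_fixed_vector] applies. *)
Lemma intertwiner k (I : finType) (a b c : I -> G k) (r : I -> C) :
  (forall i, r i * r i = 1) ->
  (forall i j, sympl (a i) (a j) = sympl (b i) (b j)) ->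
  (forall i j, sympl (a i) (c j) = (i == j)%:R) ->
  exists2 M : 'M[C]_#|bits k|, M != 0 &
    forall i, pauli C (a i) *m M = r i *: (M *m pauli C (b i)).
Proof.
move=> hr hab hac.
pose L i (M : 'M[C]_#|bits k|) := r i *: (pauli C (a i) *m M *m pauli C (b i)).
pose J i (M : 'M[C]_#|bits k|) := pauli C (c i) *m M.
have [||||||M hM h] := @joint_fixed_vector _ I L J _ (mx_bits_neq0 C k); last 1 first.
- exists M => // i; rewrite -{2}(h i) /L -scalemxAl scalerA hr scale1r.
  by rewrite -mulmxA pauli_sq mulmx1.
- by move=> i u v; rewrite /L mulmxDr mulmxDl scalerDr.
- move=> i v; rewrite /L -scalemxAr -scalemxAl scalerA hr scale1r.
  by rewrite !mulmxA pauli_sq mul1mx -mulmxA pauli_sq mulmx1.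
- move=> i j v; rewrite /L -!scalemxAr -!scalemxAl !scalerA mulrC; congr (_ *: _).
  rewrite !mulmxA pauli_comm -!mulmxA [pauli C (b j) *m pauli C (b i)]pauli_comm.
  rewrite -!scalemxAr -scalemxAl scalerA -hab [sympl (a j) _]symplC sgnMsgn scale1r.
  by rewrite !mulmxA.
- by move=> i v /(congr1 (mulmx (pauli C (c i)))); rewrite mulmx0 mulmxA pauli_sq mul1mx.
- move=> i v; rewrite /L /J -scaleN1r -!scalemxAr mulmxA pauli_comm hac eqxx sgn1.
  by rewrite -!scalemxAl !mulmxA scalerA mulrC -scalerA.
- move=> i j v ji; rewrite /L /J mulmxA pauli_comm hac (negPf ji) sgn0 scale1r.
  by rewrite -!scalemxAr !mulmxA.
Qed.

(** Irreducibility of the Pauli group: commuting with every Z makes [D] diagonal, and commuting with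
    every X makes the diagonal constant. *)
Lemma commutant_scalar k (D : 'M[C]_#|bits k|) :
  (forall i, D *m pauli C (genX (pred1 i)) = pauli C (genX (pred1 i)) *m D) ->
  (forall i, D *m pauli C (genZ (pred1 i)) = pauli C (genZ (pred1 i)) *m D) ->
  exists d, D = d%:M.
Proof.
move=> hX hZ; pose d := opmx D.
have DE : D = mxop d by rewrite opmxK.
have hoff x y : x != y -> d x y = 0.
  move=> xy; have /existsP[i hi] : [exists i, x i != y i].
    by rewrite -negb_forall -bits_eq.
  have := hZ i; rewrite DE -!mxopM => /mxop_inj/(congr1 (fun f => f x y)) /=.
  rewrite (bigD1 y) //= big1 => [|t ty]; last by rewrite sigma_Z (negPf ty) mul0r mulr0.
  rewrite [RHS](bigD1 x) //= [X in _ = _ + X]big1 => [|t tx]; last first.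
    by rewrite sigma_Z eq_sym (negPf tx) !mul0r.
  have zE z : \prod_j (-1) ^+ (pred1 i j && z j) = (-1) ^+ (z i) :> C.
    by rewrite (bigD1 i) //= eqxx big1 ?mulr1 // => j /negPf ->.
  rewrite !sigma_Z !eqxx !mul1r !zE !addr0.
  have two (c : C) : c = - c -> c = 0.
    by move/eqP; rewrite -addr_eq0 -mulr2n mulrn_eq0 => /eqP.
  case: (x i) (y i) hi => [] [] //= _; rewrite ?expr0 ?expr1 ?mulr1 ?mul1r ?mulrN1 ?mulN1r.
    by move/two.
  by move/esym/two.
(* The entry at [x] and its flip [x'] of the commutation with X on qubit [i] compares the two
   diagonal entries. *)
have hflip i (x : bits k) : d [ffun j => x j (+) (j == i)] [ffun j => x j (+) (j == i)] = d x x.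
  set x' := [ffun j => _].
  have := hX i; rewrite DE -!mxopM => /mxop_inj/(congr1 (fun f => f x x')) /=.
  rewrite (bigD1 x) //= big1 => [|t tx]; last first.
    rewrite sigma_X; case: eqP => [h|]; last by rewrite mulr0.
    case/eqP: tx; apply/ffunP => j; have /ffunP/(_ j) := h.
    by rewrite !ffunE /= => /addIb.
  rewrite [RHS](bigD1 x') //= [X in _ = _ + X]big1 => [|t tx]; last first.
    by rewrite sigma_X (negPf tx) mul0r.
  by rewrite !sigma_X !eqxx !mulr1 mul1r !addr0.
exists (d [ffun=> false] [ffun=> false]).
rewrite DE; apply/matrixP => i j; rewrite !mxE.
have [->|ij] := eqVneq i j; last by rewrite hoff // (inj_eq enum_val_inj).
exact: (flip_invariant (fun i x => hflip i x)).
Qed.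
End Quantum.

(** * Clifford unitaries *)

Section Clifford.
Variable C : numClosedFieldType.

Lemma hc_mul_diag m n (M : 'M[C]_(m, n)) j :
  (hc M *m M) j j = \sum_i `|M i j| ^+ 2.
Proof. by rewrite mxE; apply: eq_bigr => i _; rewrite !mxE normCK mulrC. Qed.

Lemma hc_mul_eq0 m n (M : 'M[C]_(m, n)) : hc M *m M = 0 -> M = 0.
Proof.
move=> h; apply/matrixP => i j; rewrite mxE.
have := hc_mul_diag M j; rewrite h mxE => /esym/eqP.
rewrite psumr_eq0 => [|l _]; last exact: exprn_ge0.
by move/allP/(_ i); rewrite mem_index_enum sqrf_eq0 normr_eq0 => /(_ isT)/eqP.
Qed.

Lemma G_ind k (Q : G k -> Prop) :
  Q 0 -> (forall f g, Q f -> Q g -> Q (f + g)) ->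
  (forall i, Q (genX (pred1 i))) -> (forall i, Q (genZ (pred1 i))) -> forall f, Q f.
Proof.
move=> Q0 QD QX QZ [a b].
have -> : (a, b) = (a, 0) + (0, b) :> G k.
  by congr (_, _); rewrite /= ?addr0 ?add0r.
apply: (QD).
  rewrite [a]row_sum_delta; apply: (big_ind (fun v => Q (v, 0))) => [//|u v hu hv|i _].
    suff -> : (u + v, 0) = (u, 0) + (v, 0) :> G k by apply: (QD).
    by congr (_, _); rewrite /= addr0.
  case: (F2_cases (a 0 i)) => ->; first by rewrite scale0r.
  rewrite scale1r; suff -> : delta_mx 0 i = rowb (pred1 i) :> 'rV_k by apply: QX.
  by apply/rowP => j; rewrite !mxE.
rewrite [b]row_sum_delta; apply: (big_ind (fun v => Q (0, v))) => [//|u v hu hv|i _].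
  suff -> : (0, u + v) = (0, u) + (0, v) :> G k by apply: (QD).
  by congr (_, _); rewrite /= addr0.
case: (F2_cases (b 0 i)) => ->; first by rewrite scale0r.
rewrite scale1r; suff -> : delta_mx 0 i = rowb (pred1 i) :> 'rV_k by apply: QZ.
by apply/rowP => j; rewrite !mxE.
Qed.

Lemma mxop_scale k c (U : op C k) : mxop (opscale c U) = c *: mxop U.
Proof. by apply/matrixP => i j; rewrite !mxE. Qed.

(** For an intertwiner [M], the product [hc M *m M] commutes with all Paulis, hence is a scalar, and
    dividing [M] by its square root gives a unitary. Generators go to signed Paulis, so all Paulis
    do. *)
Lemma clifford_exists k (E F : 'I_k -> G k) (r s : 'I_k -> C) :
  (forall i j, [/\ sympl (E i) (F j) = (i == j)%:R, sympl (E i) (E j) = 0 &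
                   sympl (F i) (F j) = 0]) ->
  (forall i, r i = 1 \/ r i = -1) -> (forall i, s i = 1 \/ s i = -1) ->
  exists U : op C k, [/\ clifford U,
    forall i, pauli C (E i) *m mxop U = r i *: (mxop U *m pauli C (genX (pred1 i))) &
    forall i, pauli C (F i) *m mxop U = s i *: (mxop U *m pauli C (genZ (pred1 i)))].
Proof.
move=> hEF hr hs.
pose a (x : 'I_k + 'I_k) := match x with inl i => E i | inr i => F i end.
pose b (x : 'I_k + 'I_k) : G k :=
  match x with inl i => genX (pred1 i) | inr i => genZ (pred1 i) end.
(* In a symplectic basis the partner of a vector is the one that pairs with it alone. *)
pose c (x : 'I_k + 'I_k) := match x with inl i => F i | inr i => E i end.
pose q (x : 'I_k + 'I_k) := match x with inl i => r i | inr i => s i end.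
have hq x : q x = 1 \/ q x = -1 by case: x => i /=.
have hqq x : q x * q x = 1 by case: (hq x) => ->; rewrite ?mulr1 ?mulrNN ?mulr1.
have hqc x : (q x)^* = q x by case: (hq x) => ->; rewrite ?rmorphN /= conjC1.
have hE i j : sympl (E i) (E j) = 0 by case: (hEF i j).
have hF i j : sympl (F i) (F j) = 0 by case: (hEF i j).
have hX i j : sympl (E i) (F j) = (i == j)%:R by case: (hEF i j).
have hX' i j : sympl (F i) (E j) = (i == j)%:R by rewrite symplC hX eq_sym.
have hab x y : sympl (a x) (a y) = sympl (b x) (b y).
  case: x y => [i|i] [j|j]; rewrite /a /b ?sympl_XX ?sympl_ZZ ?hE ?hF //.
    by rewrite sympl_XZ hX.
  by rewrite [RHS]symplC sympl_XZ hX' eq_sym.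
have hac x y : sympl (a x) (c y) = (x == y)%:R.
  by case: x y => [i|i] [j|j]; rewrite /a /c ?hE ?hF ?hX ?hX'.
have [M M0 hM] := intertwiner hqq hab hac.
have hD x : (hc M *m M) *m pauli C (b x) = pauli C (b x) *m (hc M *m M).
  have h1 : M *m pauli C (b x) = q x *: (pauli C (a x) *m M).
    by rewrite hM scalerA hqq scale1r.
  have := congr1 (@hc _ _ _) h1; rewrite hcZ !hcM !pauli_adj hqc => h2.
  by rewrite -mulmxA h1 mulmxA h2 -scalemxAl -scalemxAr mulmxA.
have [d hd] := commutant_scalar (fun i => hD (inl i)) (fun i => hD (inr i)).
(* The scalar is the squared norm of a column of [M], hence nonnegative. *)
have dE : d = \sum_i `|M i (enum_rank [ffun=> false])| ^+ 2.
  by rewrite -hc_mul_diag hd mxE eqxx.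
have d_ge0 : 0 <= d by rewrite dE; apply: sumr_ge0 => i _; apply: exprn_ge0.
have d0 : d != 0.
  by apply: contra M0 => /eqP d0; apply/eqP/hc_mul_eq0; rewrite hd d0 raddf0.
have sd0 : sqrtC d != 0 by rewrite sqrtC_eq0.
pose U := (sqrtC d)^-1 *: M.
have UU : hc U *m U = 1%:M.
  rewrite /U hcZ -scalemxAl -scalemxAr hd scalerA fmorphV /= geC0_conj ?sqrtC_ge0 //.
  by rewrite -invfM -expr2 sqrtCK scale_scalar_mx mulVf.
have UU' : U *m hc U = 1%:M by apply: mulmx1C.
have hU x : pauli C (a x) *m U = q x *: (U *m pauli C (b x)).
  by rewrite /U -scalemxAr hM -scalemxAl !scalerA mulrC.
exists (opmx U); rewrite opmxK; split; last 2 first.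
- by move=> i; apply: (hU (inl i)).
- by move=> i; apply: (hU (inr i)).
split.
  by apply: (@mxop_inj C); rewrite mxopM mxop_adj opmxK UU' mxop_id.
have conjU x : U *m pauli C (b x) *m hc U = q x *: pauli C (a x).
  have -> : U *m pauli C (b x) = q x *: (pauli C (a x) *m U).
    by rewrite hU scalerA hqq scale1r.
  by rewrite -scalemxAl -mulmxA UU' mulmx1.
(* An arbitrary scalar is enough: both sides square to the identity, which forces it to be a
   sign. *)
suff main f : exists g e, U *m pauli C f *m hc U = e *: pauli C g.
  move=> f; have [g [e he]] := main f; exists g, e; split.
    have : (e *: pauli C g) *m (e *: pauli C g) = 1%:M.
      rewrite -he -!mulmxA (mulmxA (hc U)) UU mul1mx (mulmxA (pauli C f)) pauli_sq.
      by rewrite mul1mx.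
    rewrite -scalemxAl -scalemxAr scalerA pauli_sq -[RHS]scale1r => /eqP.
    rewrite -subr_eq0 -scalerBl scaler_eq0 (negPf (mx_bits_neq0 C k)) orbF subr_eq0.
    by rewrite -expr2 sqrf_eq1 => /orP[] /eqP ->; [left|right].
  apply: (@mxop_inj C); rewrite mxop_scale -[RHS]he.
  by rewrite [LHS]mxopM [X in X *m _]mxopM mxop_adj opmxK.
elim/G_ind: f => [|f g [f' [e he]] [g' [e' he']]|i|i].
- by exists 0, 1; rewrite pauli0 mulmx1 UU' scale1r.
- have [u hu] := pauliD C f g; have [u' hu'] := pauliD C f' g'.
  have u'0 : u' != 0.
    apply/eqP => u'0; have := pauli_sq C (f' + g'); rewrite hu' u'0 scale0r mul0mx => /esym/eqP.
    by rewrite (negPf (mx_bits_neq0 C k)).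
  exists (f' + g'), (u * e * e' / u'); rewrite hu' scalerA divfK // hu.
  rewrite -scalemxAr -scalemxAl -!scalerA; congr (_ *: _).
  rewrite scalemxAr scalemxAl -he -he' -!mulmxA (mulmxA (hc U)) UU mul1mx.
  by rewrite !mulmxA.
- by exists (E i), (r i); apply: (conjU (inl i)).
- by exists (F i), (s i); apply: (conjU (inr i)).
Qed.
End Clifford.

(** * Three-party operators and states *)

Section States.
Variable C : numClosedFieldType.

(** Pulled back along [q] to the qubits of the party, the families form a symplectic basis. For an
    index not touching the party, both sides reduce to [mxop U]. *)
Lemma party_clifford n (Ed : finType) (q : 'I_n -> Ed) (t : pred Ed) (E F : Ed -> G n)
    (r s : Ed -> C) :
  injective q -> (forall k, t k = (k \in codom q)) ->
  (forall k l, [/\ sympl (E k) (F l) = ((k == l) && t k)%:R, sympl (E k) (E l) = 0 &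
                   sympl (F k) (F l) = 0]) ->
  (forall k, ~~ t k -> E k = 0 /\ F k = 0) ->
  (forall k, r k = 1 \/ r k = -1) -> (forall k, s k = 1 \/ s k = -1) ->
  (forall k, ~~ t k -> r k = 1 /\ s k = 1) ->
  exists2 U : op C n, clifford U & forall k,
    pauli C (E k) *m mxop U = r k *: (mxop U *m pauli C (genX (fun i => q i == k))) /\
    pauli C (F k) *m mxop U = s k *: (mxop U *m pauli C (genZ (fun i => q i == k))).
Proof.
move=> qI ht hEF h0 hr hs hrs.
have [|||U [cU hX hZ]] := @clifford_exists C n (E \o q) (F \o q) (r \o q) (s \o q).
- move=> i j; have [/= -> -> ->] := hEF (q i) (q j).
  by rewrite (inj_eq qI) ht codom_f andbT.
- by move=> i; apply: hr.
- by move=> i; apply: hs.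
exists U => // k; have [tk|tk] := boolP (t k).
  have /codomP[i ->] : k \in codom q by rewrite -ht.
  have e : genX (fun j => q j == q i) = genX (pred1 i).
    by congr (_, _); apply/rowP => j; rewrite !mxE (inj_eq qI).
  have e' : genZ (fun j => q j == q i) = genZ (pred1 i).
    by congr (_, _); apply/rowP => j; rewrite !mxE (inj_eq qI).
  by rewrite e e'; split; [apply: hX|apply: hZ].
have [-> ->] := hrs k tk; have [-> ->] := h0 k tk.
have e : rowb (fun j => q j == k) = 0.
  apply/rowP => j; rewrite !mxE; case: eqP => // qj.
  by case/negP: tk; rewrite ht -qj codom_f.
by rewrite /genX /genZ e !scale1r !pauli0 mulmx1 mul1mx.
Qed.

Variables nA nB nC : nat.
Notation T3 := (bits nA * bits nB * bits nC)%type.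
Notation MA := 'M[C]_#|bits nA|.
Notation MB := 'M[C]_#|bits nB|.
Notation MC := 'M[C]_#|bits nC|.

(** States and local operators are flattened over triples of basis states; [tensE] relates the
    matrix product to [apply3]. *)
Definition colv (psi : state3 C nA nB nC) : 'cV[C]_#|{: T3}| :=
  \col_i psi (enum_val i).1.1 (enum_val i).1.2 (enum_val i).2.

Definition tens (A : MA) (B : MB) (D : MC) : 'M[C]_#|{: T3}| :=
  mxop (fun t u : T3 => opmx A t.1.1 u.1.1 * opmx B t.1.2 u.1.2 * opmx D t.2 u.2).

Lemma colv_inj f g : colv f = colv g -> forall x y z, f x y z = g x y z.
Proof.
move=> h x y z; have /colP/(_ (enum_rank (x, y, z))) := h.
by rewrite !mxE !enum_rankK.
Qed.

Lemma colv_ext f g : (forall x y z, f x y z = g x y z) -> colv f = colv g.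
Proof. by move=> h; apply/colP => i; rewrite !mxE. Qed.

Definition uncol (v : 'cV[C]_#|{: T3}|) : state3 C nA nB nC :=
  fun x y z => v (enum_rank (x, y, z)) 0.

Lemma uncolK v : colv (uncol v) = v.
Proof.
apply/colP => i; rewrite mxE /uncol; congr (v _ _).
by rewrite -!surjective_pairing enum_valK.
Qed.

Lemma sum_T3 (f : T3 -> C) : \sum_(x : bits nA) \sum_(y : bits nB) \sum_(z : bits nC) f (x, y, z)
  = \sum_t f t.
Proof.
rewrite (eq_bigr _ (fun x _ => pair_big _ _ (fun y z => f (x, y, z)))) pair_big /=.
rewrite [RHS](reindex (fun u : bits nA * (bits nB * bits nC) => (u.1, u.2.1, u.2.2))).
  by apply: eq_big => // [[? []]].
by exists (fun u : T3 => (u.1.1, (u.1.2, u.2))) => [[? []]|[[]]].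
Qed.

Lemma sum_enum_T3 (f : T3 -> C) :
  \sum_(i < #|{: T3}|) f (enum_val i) = \sum_t f t.
Proof.
rewrite [RHS](reindex (@enum_val {: T3} {: T3})) //=.
by apply: onW_bij; apply: enum_val_bij.
Qed.

Lemma tensE U V W psi :
  tens (mxop U) (mxop V) (mxop W) *m colv psi = colv (apply3 U V W psi).
Proof.
apply/colP => i; rewrite !mxE /apply3.
rewrite (sum_T3 (fun t => U _ t.1.1 * V _ t.1.2 * W _ t.2 * psi t.1.1 t.1.2 t.2)).
rewrite -sum_enum_T3; apply: eq_bigr => j _.
by rewrite !mxE !mxopK.
Qed.

Lemma tensM A B D A' B' D' :
  tens A B D *m tens A' B' D' = tens (A *m A') (B *m B') (D *m D').
Proof.
rewrite /tens -mxopM; congr mxop; apply: functional_extensionality => t.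
apply: functional_extensionality => u.
have opM (T : finType) (M N : 'M[C]_#|T|) x y :
    opmx (M *m N) x y = \sum_z opmx M x z * opmx N z y.
  by rewrite -[M in LHS]opmxK -[N in LHS]opmxK -mxopM mxopK.
rewrite !opM -sum_T3 [X in X * _]big_distrlr /= big_distrl /=.
apply: eq_bigr => x _; rewrite big_distrl /=; apply: eq_bigr => y _.
by rewrite big_distrr /=; apply: eq_bigr => z _; ring.
Qed.

Lemma tens1 : tens 1%:M 1%:M 1%:M = 1%:M.
Proof.
rewrite /tens -(mxop_id C {: T3}); congr mxop; apply: functional_extensionality => t.
apply: functional_extensionality => u.
rewrite /opmx !mxE !(inj_eq enum_rank_inj) -!natrM !mulnb; congr (_%:R); congr nat_of_bool.
Qed.

Lemma tensZ a b d A B D : tens (a *: A) (b *: B) (d *: D) = (a * b * d) *: tens A B D.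
Proof. by apply/matrixP => i j; rewrite !mxE /opmx !mxE; ring. Qed.

Lemma hc_tens A B D : hc (tens A B D) = tens (hc A) (hc B) (hc D).
Proof. by apply/matrixP => i j; rewrite !mxE /opmx !mxE !rmorphM. Qed.

Lemma colv_norm psi :
  (hc (colv psi) *m colv psi) 0 0 = \sum_x \sum_y \sum_z `|psi x y z| ^+ 2.
Proof.
rewrite hc_mul_diag (sum_T3 (fun t => `|psi t.1.1 t.1.2 t.2| ^+ 2)) -sum_enum_T3.
by apply: eq_bigr => i _; rewrite mxE.
Qed.

Lemma apply3_X (P : pred 'I_nA) (Q : pred 'I_nB) (R : pred 'I_nC) f x y z :
  apply3 (sigma C (genX P)) (sigma C (genX Q)) (sigma C (genX R)) f x y z =
  f [ffun j => x j (+) P j] [ffun j => y j (+) Q j] [ffun j => z j (+) R j].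
Proof.
rewrite /apply3 (bigD1 [ffun j => x j (+) P j]) //= [X in _ + X]big1 => [|i ni]; last first.
  by rewrite big1 // => ? _; rewrite big1 // => ? _; rewrite sigma_X (negPf ni) !mul0r.
rewrite (bigD1 [ffun j => y j (+) Q j]) //= [X in _ + X + _]big1 => [|i ni]; last first.
  by rewrite big1 // => ? _; rewrite (sigma_X C Q) (negPf ni) mulr0 !mul0r.
rewrite (bigD1 [ffun j => z j (+) R j]) //= [X in _ + X + _ + _]big1 => [|i ni]; last first.
  by rewrite (sigma_X C R) (negPf ni) mulr0 !mul0r.
by rewrite !sigma_X !eqxx !mul1r !addr0.
Qed.

Definition zsign n (P : pred 'I_n) (x : bits n) : C := \prod_j (-1) ^+ (P j && x j).

Lemma apply3_Z (P : pred 'I_nA) (Q : pred 'I_nB) (R : pred 'I_nC) f x y z :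
  apply3 (sigma C (genZ P)) (sigma C (genZ Q)) (sigma C (genZ R)) f x y z =
  zsign P x * zsign Q y * zsign R z * f x y z.
Proof.
rewrite /apply3 (bigD1 x) //= [X in _ + X]big1 => [|i ni]; last first.
  by rewrite big1 // => ? _; rewrite big1 // => ? _; rewrite sigma_Z eq_sym (negPf ni) !mul0r.
rewrite (bigD1 y) //= [X in _ + X + _]big1 => [|i ni]; last first.
  by rewrite big1 // => ? _; rewrite (sigma_Z C Q) eq_sym (negPf ni) mul0r mulr0 !mul0r.
rewrite (bigD1 z) //= [X in _ + X + _ + _]big1 => [|i ni]; last first.
  by rewrite (sigma_Z C R) eq_sym (negPf ni) mul0r mulr0 !mul0r.
by rewrite !sigma_Z !eqxx !mul1r !addr0.
Qed.
End States.

(** * States given by a hypergraph of Bell pairs and GHZ states *)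

Section EdgeStates.
Variable C : numClosedFieldType.

Lemma zsignE n (Ed : finType) (q : 'I_n -> Ed) (qI : injective q) i x :
  zsign C (fun j => q j == q i) x = (-1) ^+ (x i).
Proof.
rewrite /zsign (bigD1 i) //= eqxx big1 ?mulr1 // => j ji.
by rewrite (inj_eq qI) (negPf ji).
Qed.

Lemma zsign0 n (x : bits n) : zsign C pred0 x = 1.
Proof. by rewrite /zsign big1. Qed.

Lemma sign_eq_scale (a b : bool) (u : C) :
  (-1) ^+ a * (-1) ^+ b * u = u -> u != 0 -> a = b.
Proof.
move=> h u0; have : (-1) ^+ a * (-1) ^+ b = 1 :> C.
  by apply: (mulIf u0); rewrite h mul1r.
case: a b {h} => [] []; rewrite ?expr0 ?expr1 ?mulr1 ?mul1r // => /eqP.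
all: by rewrite eq_sym -addr_eq0 -mulr2n pnatr_eq0.
Qed.

Variables nA nB nC : nat.

Definition spread n (Ed : finType) (q : 'I_n -> Ed) (w : {ffun Ed -> bool}) : bits n :=
  [ffun i => w (q i)].

(* The product over [Ed] of (|0...0> + |1...1>)/sqrt 2, where [qX] maps a qubit of
   party X to the factor it belongs to. *)
Definition edge_state (Ed : finType) (qA : 'I_nA -> Ed) (qB : 'I_nB -> Ed)
    (qC : 'I_nC -> Ed) : state3 C nA nB nC := fun x y z =>
  (sqrtC 2)^-1 ^+ #|Ed| *
  ((x, y, z) \in codom (fun w => (spread qA w, spread qB w, spread qC w)))%:R.

(** Flip invariance makes [f] constant on the strings that assign one bit to each factor, and the
    agreement conditions make it vanish elsewhere. Agreement of B and C on a factor touching A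
    passes through A. *)
Lemma edge_state_char (Ed : finType) (qA : 'I_nA -> Ed) (qB : 'I_nB -> Ed)
    (qC : 'I_nC -> Ed) (f : state3 C nA nB nC) :
  injective qA -> injective qB -> injective qC ->
  (forall k (x : bits nA) (y : bits nB) (z : bits nC), f [ffun j => x j (+) (qA j == k)] [ffun j => y j (+) (qB j == k)]
     [ffun j => z j (+) (qC j == k)] = f x y z) ->
  (forall i j x y z, qA i = qB j -> f x y z != 0 -> x i = y j) ->
  (forall i j x y z, qA i = qC j -> f x y z != 0 -> x i = z j) ->
  (forall i j x y z, qB i = qC j -> qB i \notin codom qA -> f x y z != 0 -> y i = z j) ->
  exists c, forall x y z, f x y z = c * edge_state qA qB qC x y z.
Proof.
move=> iA iB iC hX hAB hAC hBC.
pose h (w : {ffun Ed -> bool}) := (spread qA w, spread qB w, spread qC w).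
pose g w := f (h w).1.1 (h w).1.2 (h w).2.
have hg w : g w = g [ffun=> false].
  apply: (flip_invariant (g := g)) => k u; rewrite -[RHS](hX k) /g /h /=.
  by congr f; apply/ffunP => i; rewrite !ffunE.
have s0 : sqrtC 2 != 0 :> C by rewrite sqrtC_eq0 pnatr_eq0.
exists (g [ffun=> false] * sqrtC 2 ^+ #|Ed|) => x y z.
rewrite /edge_state exprVn mulrA mulfK ?expf_neq0 //.
case: codomP => [[w [-> -> ->]]|hn]; first by rewrite mulr1 -(hg w).
rewrite mulr0; apply/eqP; apply: contraT => f0; case: hn.
(* The bit of a factor is read at A if it has a qubit there, else at B, else at C; [false] is the
   default for a factor without qubits. *)
exists [ffun k => if [pick i | qA i == k] is Some i then x i else
  if [pick i | qB i == k] is Some i then y i else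
  if [pick i | qC i == k] is Some i then z i else false].
congr (_, _, _); apply/ffunP => i; rewrite !ffunE.
- case: pickP => [j /eqP /iA -> //|/(_ i)]; by rewrite eqxx.
- case: pickP => [j /eqP e|_]; first by rewrite (hAB _ _ _ _ _ e f0).
  case: pickP => [j /eqP /iB -> //|/(_ i)]; by rewrite eqxx.
- case: pickP => [j /eqP e|nA0]; first by rewrite (hAC _ _ _ _ _ e f0).
  case: pickP => [j /eqP e|_].
    rewrite (hBC _ _ _ _ _ e _ f0) // e; apply/codomP => -[l hl].
    by have := nA0 l; rewrite hl eqxx.
  case: pickP => [j /eqP /iC -> //|/(_ i)]; by rewrite eqxx.
Qed.

(** Since every factor has a qubit, distinct assignments give distinct strings, so there are
    [2 ^ #|Ed|] of them, each of weight [2^-1 ^+ #|Ed|]. *)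
Lemma edge_state_unit (Ed : finType) (qA : 'I_nA -> Ed) (qB : 'I_nB -> Ed)
    (qC : 'I_nC -> Ed) :
  (forall k, [|| k \in codom qA, k \in codom qB | k \in codom qC]) ->
  unit_vector (edge_state qA qB qC).
Proof.
move=> hcov; rewrite /unit_vector.
pose h (w : {ffun Ed -> bool}) := (spread qA w, spread qB w, spread qC w).
have hI : injective h.
  move=> u v [/ffunP hA /ffunP hB /ffunP hC]; apply/ffunP => k.
  case/or3P: (hcov k) => /codomP[i ->]; [have := hA i|have := hB i|have := hC i];
    by rewrite !ffunE.
rewrite (sum_T3 (fun t => `|edge_state qA qB qC t.1.1 t.1.2 t.2| ^+ 2)).
have s0 : sqrtC 2 != 0 :> C by rewrite sqrtC_eq0 pnatr_eq0.
rewrite (eq_bigr (fun t => 2^-1 ^+ #|Ed| * (t \in codom h)%:R)) => [|[[x y] z] _].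
  rewrite -big_distrr /= -natr_sum.
  have -> : (\sum_t (t \in codom h) = #|codom h|)%N.
    by rewrite -sum1_card [RHS]big_mkcond; apply: eq_bigr => t _; case: (t \in _).
  rewrite card_codom // card_ffun card_bool natrX.
  by rewrite -exprMn mulVf ?expr1n // pnatr_eq0.
rewrite /edge_state /= normrM exprMn normrX exprAC normfV [`|sqrtC 2|]ger0_norm ?sqrtC_ge0 ?ler0n //.
by rewrite !exprVn sqrtCK; case: (_ \in _); rewrite ?normr1 ?normr0 ?expr1n ?expr0n.
Qed.

(* Every state touches B or C, so its signs can be absorbed by those two parties. *)
Lemma edge_stabilizer_LCU (Ed : finType) (qA : 'I_nA -> Ed) (qB : 'I_nB -> Ed)
    (qC : 'I_nC -> Ed) (tA tB tC : pred Ed) (psi : state3 C nA nB nC)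
    (X : Ed -> G3 nA nB nC) (ZA : Ed -> G nA) (ZB : Ed -> G nB) (ZC : Ed -> G nC) :
  let stab (g : G3 nA nB nC) := exists e : C, (e = 1 \/ e = -1) /\
    sigma3 g psi = (fun x y z => e * psi x y z) in
  unit_vector psi ->
  [/\ injective qA, injective qB & injective qC] ->
  [/\ forall k, tA k = (k \in codom qA), forall k, tB k = (k \in codom qB) &
      forall k, tC k = (k \in codom qC)] ->
  (forall k, tB k || tC k) ->
  (forall k l, [/\ sympl (X k).1.1 (ZA l) = ((k == l) && tA k)%:R,
     sympl (X k).1.1 (X l).1.1 = 0 & sympl (ZA k) (ZA l) = 0]) ->
  (forall k l, [/\ sympl (X k).1.2 (ZB l) = ((k == l) && tB k)%:R,
     sympl (X k).1.2 (X l).1.2 = 0 & sympl (ZB k) (ZB l) = 0]) ->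
  (forall k l, [/\ sympl (X k).2 (ZC l) = ((k == l) && tC k)%:R,
     sympl (X k).2 (X l).2 = 0 & sympl (ZC k) (ZC l) = 0]) ->
  (forall k, [/\ ~~ tA k -> (X k).1.1 = 0 /\ ZA k = 0,
     ~~ tB k -> (X k).1.2 = 0 /\ ZB k = 0 & ~~ tC k -> (X k).2 = 0 /\ ZC k = 0]) ->
  (forall k, stab (X k)) ->
  (forall k, [/\ tA k && tB k -> stab (ZA k, ZB k, 0), tA k && tC k -> stab (ZA k, 0, ZC k) &
     tB k && tC k -> stab (0, ZB k, ZC k)]) ->
  LCU_equiv psi (edge_state qA qB qC).
Proof.
move=> stab hpsi [iA iB iC] [cA cB cC] hBC HA HB HC H0 sX sZ.
have /fin_all_exists[eX heX] := sX.
have /fin_all_exists[eAB heAB] : forall k, exists e : C, (e = 1 \/ e = -1) /\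
   (tA k && tB k -> sigma3 (ZA k, ZB k, 0) psi = (fun x y z => e * psi x y z)).
  move=> k; have [h _ _] := sZ k; case: (tA k && tB k) h => [[]// e [? ?]|_]; first by exists e.
  by exists 1; split => //; left.
have /fin_all_exists[eAC heAC] : forall k, exists e : C, (e = 1 \/ e = -1) /\
   (tA k && tC k -> sigma3 (ZA k, 0, ZC k) psi = (fun x y z => e * psi x y z)).
  move=> k; have [_ h _] := sZ k; case: (tA k && tC k) h => [[]// e [? ?]|_]; first by exists e.
  by exists 1; split => //; left.
have /fin_all_exists[eBC heBC] : forall k, exists e : C, (e = 1 \/ e = -1) /\
   (tB k && tC k -> sigma3 (0, ZB k, ZC k) psi = (fun x y z => e * psi x y z)).
  move=> k; have [_ _ h] := sZ k; case: (tB k && tC k) h => [[]// e [? ?]|_]; first by exists e.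
  by exists 1; split => //; left.
have pm1 : (1 : C) = 1 \/ (1 : C) = -1 by left.
(* The sign of an X stabilizer goes to C if its state touches C, else to B. The sign of ZZ on A and
   B goes to B; C takes that of ZZ with A, or with B when the state misses A. *)
pose rB k := if tB k && ~~ tC k then eX k else 1.
pose rC k := if tC k then eX k else 1.
pose sB k := if tA k && tB k then eAB k else 1.
pose sC k := if tC k then (if tA k then eAC k else eBC k) else 1.
have [UA cUA hA] := party_clifford iA cA HA (fun k => let: And3 h _ _ := H0 k in h)
  (fun=> pm1) (fun=> pm1) (fun _ _ => conj erefl erefl).
have [|||UB cUB hB] := @party_clifford C _ _ _ _ _ _ rB sB iB cB HB
  (fun k => let: And3 _ h _ := H0 k in h).
- by move=> k; rewrite /rB; case: ifP => // _; case: (heX k).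
- by move=> k; rewrite /sB; case: ifP => // _; case: (heAB k).
- by move=> k /negPf h; rewrite /rB /sB h andbF.
have [|||UC cUC hC] := @party_clifford C _ _ _ _ _ _ rC sC iC cC HC
  (fun k => let: And3 _ _ h := H0 k in h).
- by move=> k; rewrite /rC; case: ifP => // _; case: (heX k).
- move=> k; rewrite /sC; case: (tC k) => //.
  by have [? _] := heAC k; have [? _] := heBC k; case: (tA k).
- by move=> k /negPf h; rewrite /rC /sC h.
have unitmx_of n (U : op C n) : clifford U ->
    mxop U *m hc (mxop U) = 1%:M /\ hc (mxop U) *m mxop U = 1%:M.
  case=> /(congr1 (@mxop C _)); rewrite mxopM mxop_adj mxop_id => h _.
  by split=> //; apply: mulmx1C.
have [UA1 UA2] := unitmx_of _ _ cUA; have [UB1 UB2] := unitmx_of _ _ cUB.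
have [UC1 UC2] := unitmx_of _ _ cUC.
pose W := tens (mxop UA) (mxop UB) (mxop UC).
have W1 : W *m hc W = 1%:M by rewrite hc_tens tensM UA1 UB1 UC1 tens1.
have W2 : hc W *m W = 1%:M by rewrite hc_tens tensM UA2 UB2 UC2 tens1.
pose phi := hc W *m colv psi; pose f := uncol phi.
have fE : colv f = phi by apply: uncolK.
have psiE : colv psi = W *m colv f by rewrite fE mulmxA W1 mul1mx.
(* When the three local signs multiply to the stabilizer sign [e], the pulled-back state [f] is
   fixed without a sign. *)
have transfer (g : G3 nA nB nC) (e a b c : C) QA QB QC : (e = 1 \/ e = -1) ->
    sigma3 g psi = (fun x y z => e * psi x y z) ->
    pauli C g.1.1 *m mxop UA = a *: (mxop UA *m pauli C QA) ->
    pauli C g.1.2 *m mxop UB = b *: (mxop UB *m pauli C QB) ->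
    pauli C g.2 *m mxop UC = c *: (mxop UC *m pauli C QC) ->
    a * b * c = e ->
    forall x y z, apply3 (sigma C QA) (sigma C QB) (sigma C QC) f x y z = f x y z.
  move=> he hg ha hb hc' habc; apply: colv_inj; rewrite -tensE.
  have : tens (pauli C g.1.1) (pauli C g.1.2) (pauli C g.2) *m colv psi = e *: colv psi.
    by rewrite tensE -/(sigma3 g psi) hg; apply/colP => i; rewrite !mxE.
  rewrite psiE mulmxA tensM ha hb hc' tensZ habc -tensM -!scalemxAl.
  have e0 : e != 0 by case: he => ->; rewrite ?oppr_eq0 oner_eq0.
  move/(scalerI e0)/(congr1 (mulmx (hc W))).
  by rewrite -!mulmxA (mulmxA (hc W)) W2 mul1mx mulmxA W2 mul1mx.
(* A party on which the stabilizer acts trivially counts as a Z operator on no qubit, so that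
   [apply3_Z] covers it. *)
have p0 n (U : op C n) : pauli C (0 : G n) *m mxop U = 1 *: (mxop U *m pauli C (genZ pred0)).
  have e : rowb (pred0 : pred 'I_n) = 0 by apply/rowP => j; rewrite !mxE.
  by rewrite /genZ e scale1r pauli0 mul1mx mulmx1.
have [c hc0] : exists c, forall x y z, f x y z = c * edge_state qA qB qC x y z.
  apply: edge_state_char => //.
  - move=> k x y z; rewrite -apply3_X; have [he hk] := heX k.
    apply: (transfer _ _ _ _ _ _ _ _ he hk (hA k).1 (hB k).1 (hC k).1).
    rewrite /rB /rC; have := hBC k.
    by case: (tC k); case: (tB k) => //= _; rewrite ?mul1r ?mulr1.
  - move=> i j x y z e f0; have [he hk] := heAB (qA i).
    have tk : tA (qA i) && tB (qA i) by rewrite cA cB {2}e !codom_f.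
    have zj : zsign C (fun l => qB l == qA i) y = (-1) ^+ (y j).
      by rewrite e zsignE.
    have := transfer _ _ _ _ _ _ _ _ he (hk tk) (hA _).2 (hB _).2 (p0 _ _) _ x y z.
    rewrite apply3_Z zsign0 !(mulr1, mul1r) zsignE // zj => h.
    by apply: sign_eq_scale f0; apply: h; rewrite /sB tk.
  - move=> i j x y z e f0; have [he hk] := heAC (qA i).
    have tk : tA (qA i) && tC (qA i) by rewrite cA cC {2}e !codom_f.
    have zj : zsign C (fun l => qC l == qA i) z = (-1) ^+ (z j).
      by rewrite e zsignE.
    have := transfer _ _ _ _ _ _ _ _ he (hk tk) (hA _).2 (p0 _ _) (hC _).2 _ x y z.
    rewrite apply3_Z zsign0 !(mulr1, mul1r) zsignE // zj => h.
    by apply: sign_eq_scale f0; apply: h; rewrite /sC; case/andP: tk => -> ->.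
  - move=> i j x y z e niA f0; have [he hk] := heBC (qB i).
    have tk : tB (qB i) && tC (qB i) by rewrite cB cC {2}e !codom_f.
    have tA0 : tA (qB i) = false by rewrite cA; apply: negbTE.
    have zj : zsign C (fun l => qC l == qB i) z = (-1) ^+ (z j).
      by rewrite e zsignE.
    have := transfer _ _ _ _ _ _ _ _ he (hk tk) (p0 _ _) (hB _).2 (hC _).2 _ x y z.
    rewrite apply3_Z zsign0 !(mulr1, mul1r) zsignE // zj => h.
    apply: sign_eq_scale f0; apply: h; by rewrite /sB /sC tA0 mul1r; case/andP: tk => _ ->.
(* Both [f], a unitary image of [psi], and the edge state have norm one. *)
have c1 : `|c| = 1.
  have := colv_norm f; rewrite fE /phi hcM hcK -mulmxA (mulmxA W) W1 mul1mx colv_norm hpsi.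
  have cov k : [|| k \in codom qA, k \in codom qB | k \in codom qC].
    by rewrite -cA -cB -cC hBC orbT.
  have hu := edge_state_unit cov; rewrite /unit_vector in hu.
  have -> : \sum_x \sum_y \sum_z `|f x y z| ^+ 2 = `|c| ^+ 2.
    rewrite -[RHS]mulr1 -[X in _ = _ * X]hu.
    rewrite big_distrr; apply: eq_bigr => x _; rewrite big_distrr; apply: eq_bigr => y _.
    by rewrite big_distrr; apply: eq_bigr => z _; rewrite hc0 normrM exprMn.
  by move/esym/eqP; rewrite sqrp_eq1 // => /eqP.
exists UA, UB, UC, c; split=> //; apply: colv_inj.
rewrite psiE /W tensE; apply: colv_ext => x y z; rewrite /apply3 mulr_sumr.
apply: eq_bigr => x' _; rewrite mulr_sumr; apply: eq_bigr => y' _; rewrite mulr_sumr.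
by apply: eq_bigr => z' _; rewrite hc0; ring.
Qed.
End EdgeStates.

(** * Qubit layout of the target *)

Section Layout.
Variable C : numClosedFieldType.
Variables kA kB kC p : nat.
Notation edge := (edge kA kB kC p).

(** Two blocks of Bell-pair qubits followed by the GHZ qubits, in the order of [target]. *)
Definition layout a b (f : 'I_a -> edge) (g : 'I_b -> edge) (i : 'I_(a + b + p)) : edge :=
  match split i with
  | inl j => match split j with inl c => f c | inr d => g d end
  | inr m => inr m
  end.

Definition edgeC (i : 'I_kC) : edge := inl (inl (inl i)).
Definition edgeB (i : 'I_kB) : edge := inl (inl (inr i)).
Definition edgeA (i : 'I_kA) : edge := inl (inr i).

Definition layoutA := layout edgeC edgeB.
Definition layoutB := layout edgeC edgeA.
Definition layoutC := layout edgeB edgeA.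

Lemma layoutL a b (f : 'I_a -> edge) (g : 'I_b -> edge) i :
  layout f g (lshift p (lshift b i)) = f i.
Proof. by rewrite /layout !(unsplitK (inl _)). Qed.

Lemma layoutM a b (f : 'I_a -> edge) (g : 'I_b -> edge) i :
  layout f g (lshift p (rshift a i)) = g i.
Proof. by rewrite /layout (unsplitK (inl _)) (unsplitK (inr _)). Qed.

Lemma layoutR a b (f : 'I_a -> edge) (g : 'I_b -> edge) i :
  layout f g (rshift (a + b) i) = inr i.
Proof. by rewrite /layout (unsplitK (inr _)). Qed.

Lemma ord3P a b (P : 'I_(a + b + p) -> Prop) :
  (forall i, P (lshift p (lshift b i))) -> (forall i, P (lshift p (rshift a i))) ->
  (forall i, P (rshift (a + b) i)) -> forall i, P i.
Proof.
move=> h1 h2 h3 i; rewrite -(splitK i); case: (split i) => j /=; last exact: h3.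
rewrite -(splitK j); case: (split j) => l /=; [exact: h1|exact: h2].
Qed.

Lemma layout_inj a b (f : 'I_a -> edge) (g : 'I_b -> edge) :
  injective f -> injective g -> (forall i j, f i <> g j) ->
  (forall i j, f i <> inr j) -> (forall i j, g i <> inr j) -> injective (layout f g).
Proof.
move=> fI gI fg fp gp.
elim/ord3P=> i; elim/ord3P=> j; rewrite ?layoutL ?layoutM ?layoutR.
- by move/fI ->.
- by move/fg.
- by move/fp.
- by move/esym/fg.
- by move/gI ->.
- by move/gp.
- by move/esym/fp.
- by move/esym/gp.
- by case=> ->.
Qed.

Lemma layoutA_inj : injective layoutA.
Proof. by apply: layout_inj => // i j []. Qed.
Lemma layoutB_inj : injective layoutB.
Proof. by apply: layout_inj => // i j []. Qed.
Lemma layoutC_inj : injective layoutC.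
Proof. by apply: layout_inj => // i j []. Qed.

Lemma touchA_codom k : touchA k = (k \in codom layoutA).
Proof.
apply/idP/codomP => [|[i ->]]; last first.
  by elim/ord3P: i => i; rewrite /layoutA ?layoutL ?layoutM ?layoutR.
case: k => [[[i|i]|i]|i] // _; [exists (lshift p (lshift kB i))|
  exists (lshift p (rshift kC i))|exists (rshift (kC + kB) i)];
  by rewrite /layoutA ?layoutL ?layoutM ?layoutR.
Qed.
Lemma touchB_codom k : touchB k = (k \in codom layoutB).
Proof.
apply/idP/codomP => [|[i ->]]; last first.
  by elim/ord3P: i => i; rewrite /layoutB ?layoutL ?layoutM ?layoutR.
case: k => [[[i|i]|i]|i] // _; [exists (lshift p (lshift kA i))|
  exists (lshift p (rshift kC i))|exists (rshift (kC + kA) i)];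
  by rewrite /layoutB ?layoutL ?layoutM ?layoutR.
Qed.
Lemma touchC_codom k : touchC k = (k \in codom layoutC).
Proof.
apply/idP/codomP => [|[i ->]]; last first.
  by elim/ord3P: i => i; rewrite /layoutC ?layoutL ?layoutM ?layoutR.
case: k => [[[i|i]|i]|i] // _; [exists (lshift p (lshift kA i))|
  exists (lshift p (rshift kB i))|exists (rshift (kB + kA) i)];
  by rewrite /layoutC ?layoutL ?layoutM ?layoutR.
Qed.

Lemma getbE n (x : bits n) (i : 'I_n) m : nat_of_ord i = m -> getb x m = x i.
Proof. by move=> <-; rewrite /getb valK. Qed.

Lemma prod_indicator (I : finType) (P : pred I) :
  \prod_(i : I) (if P i then (sqrtC 2)^-1 else 0) =
  (sqrtC 2)^-1 ^+ #|I| * [forall i, P i]%:R :> C.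
Proof.
rewrite -prod_nat_eq -prodr_const -big_split; apply: eq_bigr => i _ /=.
by case: (P i); rewrite ?mulr1 ?mulr0.
Qed.

(** Both sides are the same power of [(sqrtC 2)^-1] times an indicator, so only the supports have to
    be compared. *)
Lemma target_edge_state :
  @target C (kC + kB + p) (kC + kA + p) (kB + kA + p) kA kB kC p =
  edge_state C layoutA layoutB layoutC.
Proof.
apply: functional_extensionality => x; apply: functional_extensionality => y.
apply: functional_extensionality => z; rewrite /target /edge_state /bell /ghz.
rewrite !prod_indicator !card_ord !card_sum !card_ord !exprD.
set a := [forall _, _]; set b := [forall _, _]; set c := [forall _, _]; set d := [forall _, _].
suff -> : ((x, y, z) \in codom (fun w => (spread layoutA w, spread layoutB w, spread layoutC w)))
   = [&& a, b, c & d].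
  by rewrite -!mulnb !natrM; ring.
have gA1 i := getbE x (i := lshift p (lshift kB i)) (erefl (nat_of_ord i)).
have gA2 i := getbE x (i := lshift p (rshift kC i)) (erefl (kC + i)%N).
have gA3 i := getbE x (i := rshift (kC + kB) i) (erefl (kC + kB + i)%N).
have gB1 i := getbE y (i := lshift p (lshift kA i)) (erefl (nat_of_ord i)).
have gB2 i := getbE y (i := lshift p (rshift kC i)) (erefl (kC + i)%N).
have gB3 i := getbE y (i := rshift (kC + kA) i) (erefl (kC + kA + i)%N).
have gC1 i := getbE z (i := lshift p (lshift kA i)) (erefl (nat_of_ord i)).
have gC2 i := getbE z (i := lshift p (rshift kB i)) (erefl (kB + i)%N).
have gC3 i := getbE z (i := rshift (kB + kA) i) (erefl (kB + kA + i)%N).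
have LA := (layoutL edgeC edgeB, layoutM edgeC edgeB, layoutR edgeC edgeB).
have LB := (layoutL edgeC edgeA, layoutM edgeC edgeA, layoutR edgeC edgeA).
have LC := (layoutL edgeB edgeA, layoutM edgeB edgeA, layoutR edgeB edgeA).
apply/codomP/and4P => [[w [ex ey ez]]|].
  have eA i : x i = w (layoutA i) by rewrite ex ffunE.
  have eB i : y i = w (layoutB i) by rewrite ey ffunE.
  have eC i : z i = w (layoutC i) by rewrite ez ffunE.
  split; apply/forallP => i.
  - by rewrite gA1 gB1 eA eB /layoutA /layoutB LA LB.
  - by rewrite gA2 gC1 eA eC /layoutA /layoutC LA LC.
  - by rewrite gB2 gC2 eB eC /layoutB /layoutC LB LC.
  by rewrite gA3 gB3 gC3 eA eB eC /layoutA /layoutB /layoutC LA LB LC !eqxx.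
case=> /forallP ha /forallP hb /forallP hc' /forallP hd.
(* The bit of each state is read at A, except for the pairs of B and C, where it is read at B. *)
exists [ffun k : edge => @on_edge bool kA kB kC p (fun i => x (lshift p (lshift kB i)))
  (fun i => x (lshift p (rshift kC i))) (fun i => y (lshift p (rshift kC i)))
  (fun i => x (rshift (kC + kB) i)) k].
congr (_, _, _); apply/ffunP; elim/ord3P=> i; rewrite !ffunE.
- by rewrite /layoutA LA.
- by rewrite /layoutA LA.
- by rewrite /layoutA LA.
- by rewrite /layoutB LB /=; have := ha i; rewrite gA1 gB1 => /eqP ->.
- by rewrite /layoutB LB.
- by rewrite /layoutB LB /=; have := hd i; rewrite gA3 gB3 => /andP[/eqP ->].
- by rewrite /layoutC LC /=; have := hb i; rewrite gA2 gC1 => /eqP ->.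
- by rewrite /layoutC LC /=; have := hc' i; rewrite gB2 gC2 => /eqP ->.
- by rewrite /layoutC LC /=; have := hd i; rewrite gA3 gB3 gC3 => /andP[/eqP -> /eqP ->].
Qed.
End Layout.


(** * Self-dual subspaces and co-local subgroups *)

Lemma memvI (K : fieldType) (V : vectType K) (U W : {vspace V}) v :
  v \in U -> v \in W -> v \in (U :&: W)%VS.
Proof. by rewrite memv_cap => -> ->. Qed.

Section SymplecticSpace.

Lemma F2_mulC_add (a b : 'F_2) : a * b + b * a = 0.
Proof. by rewrite [b * a]mulrC; apply: F2_addxx F2_cases _. Qed.

Lemma sympl_lin k a (u v x : G k) : sympl (a *: u + v) x = a * sympl u x + sympl v x.
Proof.
rewrite /sympl mulr_sumr -big_split; apply: eq_bigr => j _ /=.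
rewrite !mxE !mulrDl !mulrDr !mulrA; rewrite -!addrA; congr (_ + _).
by rewrite addrCA.
Qed.

Lemma sympl_xx k (u : G k) : sympl u u = 0.
Proof. by rewrite /sympl big1 // => j _; apply: F2_mulC_add. Qed.

Lemma sympl0l k (u : G k) : sympl 0 u = 0.
Proof. by rewrite /sympl big1 // => j _; rewrite !mxE !mul0r addr0. Qed.

Lemma sympl0r k (u : G k) : sympl u 0 = 0.
Proof. by rewrite symplC sympl0l. Qed.

Lemma sympl_nondeg k (u : G k) : (forall v, sympl u v = 0) -> u = 0.
Proof.
move=> h.
have hX j : u.2 0 j = 0.
  have := h (genX (pred1 j)); rewrite /sympl (bigD1 j) //= big1 => [|l lj].
    by rewrite !mxE /= eqxx mulr0 mulr1 add0r addr0.
  by rewrite !mxE /= (negPf lj) !mulr0 addr0.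
have hZ j : u.1 0 j = 0.
  have := h (genZ (pred1 j)); rewrite /sympl (bigD1 j) //= big1 => [|l lj].
    by rewrite !mxE /= eqxx mulr0 mulr1 !addr0.
  by rewrite !mxE /= (negPf lj) !mulr0 addr0.
rewrite [u]surjective_pairing; congr (_, _); apply/rowP => j; rewrite !mxE.
  exact: hZ.
exact: hX.
Qed.

Lemma dim_G k : \dim {: G k} = (k + k)%N.
Proof.
rewrite dimvf (_ : dim (G k) = dim 'rV['F_2]_k + dim 'rV['F_2]_k)%N //.
by rewrite dim_matrix !mul1r.
Qed.

Section ThreeParties.
Variables nA nB nC : nat.
Implicit Types f g : G3 nA nB nC.

Definition wA f g := sympl f.1.1 g.1.1.
Definition wB f g := sympl f.1.2 g.1.2.
Definition wC f g := sympl f.2 g.2.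

Lemma altform_wA : altform wA.
Proof.
split=> [a u v x|u v|u]; [exact: sympl_lin|exact: symplC|exact: sympl_xx].
Qed.
Lemma altform_wB : altform wB.
Proof.
split=> [a u v x|u v|u]; [exact: sympl_lin|exact: symplC|exact: sympl_xx].
Qed.
Lemma altform_wC : altform wC.
Proof.
split=> [a u v x|u v|u]; [exact: sympl_lin|exact: symplC|exact: sympl_xx].
Qed.

Lemma altform_sympl3 : altform (@sympl3 nA nB nC).
Proof.
split=> [a u v x|u v|u]; rewrite /sympl3.
- rewrite !sympl_lin !mulrDr -!addrA; congr (_ + _).
  rewrite addrCA; congr (_ + _); rewrite [RHS]addrCA; congr (_ + _).
  by rewrite addrCA.
- by rewrite (symplC u.1.1) (symplC u.1.2) (symplC u.2).
by rewrite !sympl_xx !addr0.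
Qed.

Definition embA (a : G nA) : G3 nA nB nC := (a, 0, 0).
Definition embB (b : G nB) : G3 nA nB nC := (0, b, 0).
Definition embC (c : G nC) : G3 nA nB nC := (0, 0, c).

Lemma sympl3_embA a g : sympl3 (embA a) g = sympl a g.1.1.
Proof. by rewrite /sympl3 !sympl0l !addr0. Qed.
Lemma sympl3_embB b g : sympl3 (embB b) g = sympl b g.1.2.
Proof. by rewrite /sympl3 !sympl0l addr0 add0r. Qed.
Lemma sympl3_embC c g : sympl3 (embC c) g = sympl c g.2.
Proof. by rewrite /sympl3 !sympl0l !add0r. Qed.

Lemma dim_G3 : \dim {: G3 nA nB nC} = ((nA + nB + nC) + (nA + nB + nC))%N.
Proof.
rewrite dimvf (_ : dim (G3 nA nB nC) = dim (G nA) + dim (G nB) + dim (G nC))%N //.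
rewrite -!dimvf !dim_G; lia.
Qed.

Variable S : {vspace G3 nA nB nC}.
Hypothesis sd : self_dual S.

(** [S] is its own orthogonal for a nondegenerate form, so twice its dimension is that of the whole
    space. *)
Lemma dim_self_dual : \dim S = (nA + nB + nC)%N.
Proof.
have := @dim_perp _ _ _ altform_sympl3 fullv S.
have -> : (fullv :&: perp (@sympl3 nA nB nC) S = S)%VS.
  rewrite capfv; apply/vspaceP => x; apply/idP/idP.
    by move/(mem_perp altform_sympl3) => h; apply/sd.
  by move/sd => h; apply/(mem_perp altform_sympl3).
rewrite dim_G3 => h; suff : (\dim S + \dim S = nA + nB + nC + (nA + nB + nC))%N by lia.
apply: h => u _ hu.
have h1 : u.1.1 = 0.
  by apply: sympl_nondeg => v; have := hu (embA v) (memvf _); rewrite sympl3_embA symplC.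
have h2 : u.1.2 = 0.
  by apply: sympl_nondeg => v; have := hu (embB v) (memvf _); rewrite sympl3_embB symplC.
have h3 : u.2 = 0.
  by apply: sympl_nondeg => v; have := hu (embC v) (memvf _); rewrite sympl3_embC symplC.
by rewrite [u]surjective_pairing [u.1]surjective_pairing h1 h2 h3.
Qed.

(* A co-local subgroup is the orthogonal complement, inside S, of the party's
   own Pauli group; as that group meets S trivially, the dimensions add up. *)
Lemma dim_colocal n (emb : G n -> G3 nA nB nC) (res : G3 nA nB nC -> G n)
    (R : {vspace G3 nA nB nC}) :
  linear emb -> (forall a, res (emb a) = a) ->
  (forall a g, sympl3 (emb a) g = sympl a (res g)) ->
  (forall g, g \in R <-> g \in S /\ res g = 0) ->
  (forall a, emb a \in S -> a = 0) ->
  (\dim R + (n + n) = \dim S)%N.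
Proof.
move=> lin resK hs hR hloc.
pose e : {linear G n -> G3 nA nB nC} := HB.pack emb (GRing.isLinear.Build _ _ _ _ _ lin).
pose U := limg (linfun e).
have UP u : u \in U <-> exists a, u = emb a.
  split; first by case/memv_imgP => a _ ->; exists a; rewrite lfunE.
  by case=> a ->; rewrite -[emb a]/(e a) -lfunE memv_img // memvf.
have dU : \dim U = (n + n)%N.
  rewrite -dim_G; apply: limg_dim_eq; rewrite capfv; apply/eqP.
  rewrite -subv0; apply/subvP => a; rewrite memv_ker lfunE /= memv0 => /eqP h.
  rewrite -[a]resK h; apply/eqP/sympl_nondeg => v.
  by rewrite symplC -[sympl _ _]hs (alt0r altform_sympl3).
rewrite -dU -(@dim_perp _ _ _ altform_sympl3 S U) => [|u /UP[a ->] h]; last first.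
  have -> : a = 0.
    by apply: hloc; apply/sd => g gS; rewrite (altC altform_sympl3) h.
  by apply/eqP; have := raddf0 e => /= ->.
congr (_ + _)%N; congr (\dim _); apply/vspaceP => x; rewrite memv_cap.
apply/idP/andP => [/hR[xS hx]|[xS /(mem_perp altform_sympl3) h]].
  split=> //; apply/(mem_perp altform_sympl3) => u /UP[a ->].
  by rewrite (altC altform_sympl3) hs hx sympl0r.
apply/hR; split=> //; apply: sympl_nondeg => v.
by rewrite symplC -hs (altC altform_sympl3) h //; apply/UP; exists v.
Qed.

Lemma mem_colocA f : (f \in colocA S) <-> f \in S /\ f.1.1 = 0.
Proof. by rewrite memv_cap memv_ker lfunE; split=> [/andP[-> /eqP]|[-> /eqP]]. Qed.
Lemma mem_colocB f : (f \in colocB S) <-> f \in S /\ f.1.2 = 0.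
Proof. by rewrite memv_cap memv_ker lfunE; split=> [/andP[-> /eqP]|[-> /eqP]]. Qed.
Lemma mem_colocC f : (f \in colocC S) <-> f \in S /\ f.2 = 0.
Proof. by rewrite memv_cap memv_ker lfunE; split=> [/andP[-> /eqP]|[-> /eqP]]. Qed.

Hypotheses (lA : locA S = 0%VS) (lB : locB S = 0%VS) (lC : locC S = 0%VS).

Lemma mem_zeroAP f : f.1.1 = 0 -> f \in zeroA nA nB nC.
Proof. by move=> h; rewrite memv_ker lfunE; apply/eqP. Qed.
Lemma mem_zeroBP f : f.1.2 = 0 -> f \in zeroB nA nB nC.
Proof. by move=> h; rewrite memv_ker lfunE; apply/eqP. Qed.
Lemma mem_zeroCP f : f.2 = 0 -> f \in zeroC nA nB nC.
Proof. by move=> h; rewrite memv_ker lfunE; apply/eqP. Qed.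

Lemma local_trivA f : f \in S -> f.1.2 = 0 -> f.2 = 0 -> f = 0.
Proof.
move=> fS h1 h2; have : f \in locA S.
  by apply: memvI (mem_zeroCP h2); apply: memvI fS (mem_zeroBP h1).
by rewrite lA memv0 => /eqP.
Qed.
Lemma local_trivB f : f \in S -> f.2 = 0 -> f.1.1 = 0 -> f = 0.
Proof.
move=> fS h1 h2; have : f \in locB S.
  by apply: memvI (mem_zeroAP h2); apply: memvI fS (mem_zeroCP h1).
by rewrite lB memv0 => /eqP.
Qed.
Lemma local_trivC f : f \in S -> f.1.1 = 0 -> f.1.2 = 0 -> f = 0.
Proof.
move=> fS h1 h2; have : f \in locC S.
  by apply: memvI (mem_zeroBP h2); apply: memvI fS (mem_zeroAP h1).
by rewrite lC memv0 => /eqP.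
Qed.
Lemma embA_local a : embA a \in S -> a = 0.
Proof. by move=> aS; have [] := local_trivA aS erefl erefl. Qed.
Lemma embB_local b : embB b \in S -> b = 0.
Proof. by move=> aS; have [] := local_trivB aS erefl erefl. Qed.
Lemma embC_local c : embC c \in S -> c = 0.
Proof. by move=> aS; have [] := local_trivC aS erefl erefl. Qed.

Lemma dim_colocA : (\dim (colocA S) + (nA + nA) = nA + nB + nC)%N.
Proof.
rewrite -dim_self_dual; apply: (@dim_colocal _ embA (fun g => g.1.1)) => //.
- by move=> a u v; rewrite /embA; congr (_, _, _); rewrite /= scaler0 add0r.
- exact: sympl3_embA.
- exact: mem_colocA.
- exact: embA_local.
Qed.
Lemma dim_colocB : (\dim (colocB S) + (nB + nB) = nA + nB + nC)%N.
Proof.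
rewrite -dim_self_dual; apply: (@dim_colocal _ embB (fun g => g.1.2)) => //.
- by move=> a u v; rewrite /embB; congr (_, _, _); rewrite /= scaler0 add0r.
- exact: sympl3_embB.
- exact: mem_colocB.
- exact: embB_local.
Qed.
Lemma dim_colocC : (\dim (colocC S) + (nC + nC) = nA + nB + nC)%N.
Proof.
rewrite -dim_self_dual; apply: (@dim_colocal _ embC (fun g => g.2)) => //.
- by move=> a u v; rewrite /embC; congr (_, _, _); rewrite /= scaler0 add0r.
- exact: sympl3_embC.
- exact: mem_colocC.
- exact: embC_local.
Qed.

(** The zero sum is the isotropy of [S]. If [f] in [S] is [wA]-orthogonal to [S], its restriction to
    A, extended by zero, is orthogonal to [S]; self-duality puts it in [S], and full local ranks
    make it zero. *)
Lemma tripartite_colocal : tripartite S wA wB wC (colocA S) (colocB S) (colocC S).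
Proof.
split; [exact: altform_wA|exact: altform_wB|exact: altform_wC|..].
- by move=> f g fS gS; apply: (sd f).1.
- move=> f; split=> [/mem_colocA[fS f0]|[fS h]].
    by split=> // g _; rewrite /wA f0 sympl0l.
  apply/mem_colocA; split=> //; apply: embA_local; apply/sd => g gS.
  by rewrite sympl3_embA; apply: h.
- move=> f; split=> [/mem_colocB[fS f0]|[fS h]].
    by split=> // g _; rewrite /wB f0 sympl0l.
  apply/mem_colocB; split=> //; apply: embB_local; apply/sd => g gS.
  by rewrite sympl3_embB; apply: h.
- move=> f; split=> [/mem_colocC[fS f0]|[fS h]].
    by split=> // g _; rewrite /wC f0 sympl0l.
  apply/mem_colocC; split=> //; apply: embC_local; apply/sd => g gS.
  by rewrite sympl3_embC; apply: h.
- by move=> f /mem_colocA[fS h1] /mem_colocB[_ h2]; apply: local_trivC.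
have := dim_colocA; have := dim_colocB; have := dim_colocC; have := dim_self_dual; lia.
Qed.
End ThreeParties.
End SymplecticSpace.

(** * Assembling the decomposition *)

(** The qubit numbers stay variables tied by equations; substituting them gives [target] the types
    of the layout. *)
Lemma LCU_target (C : numClosedFieldType) (kA kB kC p nA nB nC : nat)
    (psi : state3 C nA nB nC) (X : edge kA kB kC p -> G3 nA nB nC)
    (ZA : edge kA kB kC p -> G nA) (ZB : edge kA kB kC p -> G nB)
    (ZC : edge kA kB kC p -> G nC) :
  nA = (kC + kB + p)%N -> nB = (kC + kA + p)%N -> nC = (kB + kA + p)%N ->
  let stab (g : G3 nA nB nC) := exists e : C, (e = 1 \/ e = -1) /\
    sigma3 g psi = (fun x y z => e * psi x y z) in
  unit_vector psi ->
  (forall k l, [/\ sympl (X k).1.1 (ZA l) = ((k == l) && touchA k)%:R,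
     sympl (X k).1.1 (X l).1.1 = 0 & sympl (ZA k) (ZA l) = 0]) ->
  (forall k l, [/\ sympl (X k).1.2 (ZB l) = ((k == l) && touchB k)%:R,
     sympl (X k).1.2 (X l).1.2 = 0 & sympl (ZB k) (ZB l) = 0]) ->
  (forall k l, [/\ sympl (X k).2 (ZC l) = ((k == l) && touchC k)%:R,
     sympl (X k).2 (X l).2 = 0 & sympl (ZC k) (ZC l) = 0]) ->
  (forall k, [/\ ~~ touchA k -> (X k).1.1 = 0 /\ ZA k = 0,
     ~~ touchB k -> (X k).1.2 = 0 /\ ZB k = 0 & ~~ touchC k -> (X k).2 = 0 /\ ZC k = 0]) ->
  (forall k, stab (X k)) ->
  (forall k, [/\ touchA k && touchB k -> stab (ZA k, ZB k, 0),
     touchA k && touchC k -> stab (ZA k, 0, ZC k) &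
     touchB k && touchC k -> stab (0, ZB k, ZC k)]) ->
  LCU_equiv psi (@target C nA nB nC kA kB kC p).
Proof.
move=> eA eB eC; subst nA nB nC => stab psi1 HA HB HC H0 sX sZ.
rewrite target_edge_state.
apply: (edge_stabilizer_LCU psi1 _ _ _ HA HB HC H0 sX sZ).
- by split; [exact: layoutA_inj|exact: layoutB_inj|exact: layoutC_inj].
- by split; [exact: touchA_codom|exact: touchB_codom|exact: touchC_codom].
by case=> [[[?|?]|?]|?].
Qed.

(** Adding the dimension equations of two parties gives twice the qubit number of the third. *)
Lemma block_sizes (nA nB nC dA dB dC kA kB kC p : nat) :
  (dA = kA + kA + p -> dB = kB + kB + p -> dC = kC + kC + p ->
   dA + (nA + nA) = nA + nB + nC -> dB + (nB + nB) = nA + nB + nC ->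
   dC + (nC + nC) = nA + nB + nC ->
   [/\ nA = kC + kB + p, nB = kC + kA + p & nC = kB + kA + p])%N.
Proof. by move=> *; split; lia. Qed.

Lemma stabilizer_decomposition (C : numClosedFieldType) (nA nB nC : nat)
    (S : {vspace G3 nA nB nC}) (psi : state3 C nA nB nC) :
  stabilizer_state S psi ->
  locA S = 0%VS -> locB S = 0%VS -> locC S = 0%VS ->
  exists p kA kB kC,
    [/\ p = (\dim S - \dim (Sloc S))%N,
        [/\ \dim (colocA S) = (kA + kA + p)%N, \dim (colocB S) = (kB + kB + p)%N &
            \dim (colocC S) = (kC + kC + p)%N],
        [/\ nA = (kC + kB + p)%N, nB = (kC + kA + p)%N & nC = (kB + kA + p)%N] &
        LCU_equiv psi (@target C nA nB nC kA kB kC p)].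
Proof.
move=> [sd [psi1 hst]] lA lB lC.
have := tri_normal_form F2_cases (tripartite_colocal sd lA lB lC).
case=> p [kA [kB [kC [X [ZA [ZB [ZC [[hp eA eB eC] [hypA hypB hypC] hX hZ]]]]]]]].
exists p, kA, kB, kC.
have [nAE nBE nCE] : [/\ nA = (kC + kB + p)%N, nB = (kC + kA + p)%N & nC = (kB + kA + p)%N].
  exact: (block_sizes eA eB eC (dim_colocA sd lA) (dim_colocB sd lB) (dim_colocC sd lC)).
split; [exact: hp|by split|by split|].
have XS k : X k \in S by have [] := hX k.
(* Elements that differ by a co-local element of a party have the same restriction to it, so each ZZ
   operator below is the actual element [z] of [S]. *)
have colA f g : f - g \in colocA S -> f.1.1 = g.1.1.
  by move/mem_colocA => [_ /eqP]; rewrite subr_eq0 => /eqP.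
have colB f g : f - g \in colocB S -> f.1.2 = g.1.2.
  by move/mem_colocB => [_ /eqP]; rewrite subr_eq0 => /eqP.
have colC f g : f - g \in colocC S -> f.2 = g.2.
  by move/mem_colocC => [_ /eqP]; rewrite subr_eq0 => /eqP.
apply: (@LCU_target C kA kB kC p nA nB nC psi X (fun k => (ZA k).1.1)
  (fun k => (ZB k).1.2) (fun k => (ZC k).2) nAE nBE nCE psi1 hypA hypB hypC).
- move=> k; have [_ hA hB hC] := hX k; split=> [/hA|/hB|/hC] [/=].
  + by move=> /mem_colocA[_ ->] ->.
  + by move=> /mem_colocB[_ ->] ->.
  + by move=> /mem_colocC[_ ->] ->.
- by move=> k; apply: hst.
move=> k; have [hAB hAC hBC] := hZ k.
split=> [/hAB|/hAC|/hBC] [z hz [h1 h2]].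
- have [zS z0] := (mem_colocC _ _).1 hz; rewrite (colA _ _ h1) (colB _ _ h2) -z0.
  by rewrite -!surjective_pairing; apply: hst.
- have [zS z0] := (mem_colocB _ _).1 hz; rewrite (colA _ _ h1) (colC _ _ h2) -z0.
  by rewrite -!surjective_pairing; apply: hst.
have [zS z0] := (mem_colocA _ _).1 hz; rewrite (colB _ _ h1) (colC _ _ h2) -z0.
by rewrite -!surjective_pairing; apply: hst.
Qed.

Theorem theorem5 (C : numClosedFieldType) (nA nB nC : nat)
  (S : {vspace G3 nA nB nC}) (psi : state3 C nA nB nC) :
  stabilizer_state S psi ->
  locA S = 0%VS -> locB S = 0%VS -> locC S = 0%VS ->
  let p := (\dim S - \dim (Sloc S))%N in
  let dA := \dim (colocA S) in
  let dB := \dim (colocB S) in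
  let dC := \dim (colocC S) in
  [/\ (p <= dA)%N /\ ~~ odd (dA - p), (p <= dB)%N /\ ~~ odd (dB - p),
      (p <= dC)%N /\ ~~ odd (dC - p) &
   let kA := ((dA - p)./2)%N in
   let kB := ((dB - p)./2)%N in
   let kC := ((dC - p)./2)%N in
   [/\ nA = (kC + kB + p)%N, nB = (kC + kA + p)%N, nC = (kB + kA + p)%N &
       LCU_equiv psi (@target C nA nB nC kA kB kC p)]].
Proof.
move=> hS lA lB lC.
have [p [kA [kB [kC [hp [hA hB hC] hn hLCU]]]]] := stabilizer_decomposition hS lA lB lC.
(* The dimensions are generalized to variables, so that the counts can be rewritten inside the type
   of the target state. *)
suff block_counts (q a b c : nat) :
    p = q -> a = (kA + kA + p)%N -> b = (kB + kB + p)%N -> c = (kC + kC + p)%N ->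
    [/\ (q <= a)%N /\ ~~ odd (a - q), (q <= b)%N /\ ~~ odd (b - q),
        (q <= c)%N /\ ~~ odd (c - q) &
     let iA := ((a - q)./2)%N in
     let iB := ((b - q)./2)%N in
     let iC := ((c - q)./2)%N in
     [/\ nA = (iC + iB + q)%N, nB = (iC + iA + q)%N, nC = (iB + iA + q)%N &
         LCU_equiv psi (@target C nA nB nC iA iB iC q)]].
  exact: (block_counts _ _ _ _ hp hA hB hC).
move=> <- -> -> ->; rewrite /= !leq_addl !addnK !addnn !odd_double !doubleK.
by case: hn.
Qed.
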